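(* Let $N\ge 1$ and let $f_1,\dots,f_N$ be fermionic annihilation operators on the Fock space $\mathcal F\cong\mathbb C^{2^N}$, satisfying $\{f_i,f_j^\dagger\}=\delta_{ij}$, $\{f_i,f_j\}=0$. Let $\{1,\dots,N\}=A\sqcup B$ be a partition into disjoint sets with $|A|\ge|B|$. Let $h$ be a Hermitian $N\times N$ matrix with $h_{ij}=0$ whenever $i,j\in A$ or $i,j\in B$, and let $$H_F=\sum_{i\in A,\,j\in B} f_i^\dagger h_{ij} f_j+\mathrm{H.c.}$$ Then there exists an orthonormal basis $\{|E_s\rangle\}_{s\in\{0,1\}^N}$ of $\mathcal F$ consisting of pure Gaussian states that are simultaneous eigenvectors of $H_F$ and of the number operator $\hat N=\sum_i f_i^\dagger f_i$, and integers $n(s)\in\{0,1,\dots,|B|\}$, such that for every $s$ and every Rényi index $\alpha$ one has $S_\alpha(B|E_s)=n(s)$. Moreover, at least one of these basis vectors is a ground state of $H_F$ (an eigenvector for the smallest eigenvalue) with $n(s)=|B|$, i.e. it is maximally entangled between $A$ and $B$.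
   Context: Gaussian states: states satisfying Wick's theorem, i.e. determined by their two-point correlation functions (e.g. Slater determinants $a_{k_1}^\dagger\cdots a_{k_m}^\dagger|0\rangle$ built from orthonormal single-particle modes, $|0\rangle$ the vacuum annihilated by all $f_j$). For a pure state $|\psi\rangle$, the reduced state $\rho_B$ on the modes in $B$ is the density matrix on the Fock space of the modes $\{f_j\}_{j\in B}$ reproducing the expectation values of all operators in the algebra generated by $\{f_j,f_j^\dagger\}_{j\in B}$ (equivalently, order the modes with $B$ first, identify Fock space with $\mathbb C^{2^{|B|}}\otimes\mathbb C^{2^{|A|}}$ and take the partial trace over $A$). $S_\alpha(B|\psi)=\frac{1}{1-\alpha}\log_2\operatorname{Tr}\rho_B^\alpha$ (with $\alpha=1$ the von Neumann entropy $-\operatorname{Tr}\rho_B\log_2\rho_B$), i.e. entropies are measured in units of $\log 2$; the maximal possible value is $|B|$. *)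

(* Defs.v *)
From mathcomp Require Import all_boot all_order all_algebra all_fingroup.
From mathcomp Require Import complex.
From mathcomp Require Import reals exp.
Set Implicit Arguments. Unset Strict Implicit. Unset Printing Implicit Defensive.
Import Order.TTheory GRing.Theory Num.Theory.
Local Open Scope ring_scope.

Section Fermions.
Variable R : realType.
Local Notation C := (R[i]).

Definition adjm m n (A : 'M[C]_(m, n)) : 'M[C]_(n, m) := (map_mx Num.conj A)^T.

Definition mprod n (l : seq 'M[C]_n) : 'M[C]_n := foldr (fun A B => A *m B) 1%:M l.

Definition expect n (psi : 'cV[C]_n) (X : 'M[C]_n) : C := (adjm psi *m X *m psi) 0 0.

Definition CAR_on N n (S : {set 'I_N}) (g : 'I_N -> 'M[C]_n) : Prop :=
  forall i j, i \in S -> j \in S ->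
    g i *m adjm (g j) + adjm (g j) *m g i = (i == j)%:R%:M /\
    g i *m g j + g j *m g i = 0.

Definition CAR N n (f : 'I_N -> 'M[C]_n) : Prop := CAR_on [set: 'I_N] f.

Definition fop N n (f : 'I_N -> 'M[C]_n) (x : 'I_N * bool) : 'M[C]_n :=
  if x.2 then adjm (f x.1) else f x.1.

Definition word N n (f : 'I_N -> 'M[C]_n) (w : seq ('I_N * bool)) : 'M[C]_n :=
  mprod [seq fop f x | x <- w].

Definition majorana N n (f : 'I_N -> 'M[C]_n) (x : 'I_N * bool) : 'M[C]_n :=
  if x.2 then 'i%C *: (adjm (f x.1) - f x.1) else f x.1 + adjm (f x.1).

Lemma ev_proof k (i : 'I_k) : (i.*2 < k.*2)%N.
Proof. by rewrite ltn_double. Qed.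
Lemma od_proof k (i : 'I_k) : (i.*2.+1 < k.*2)%N.
Proof. by rewrite -doubleS leq_double. Qed.
Definition ev k (i : 'I_k) : 'I_(k.*2) := Ordinal (ev_proof i).
Definition od k (i : 'I_k) : 'I_(k.*2) := Ordinal (od_proof i).

Definition pfaffian k (M : 'M[C]_(k.*2)) : C :=
  (2 ^ k * k`!)%:R^-1 *
  \sum_(s : 'S_(k.*2)) (-1) ^+ s * \prod_(i < k) M (s (ev i)) (s (od i)).

(** pure fermionic Gaussian state w.r.t. the modes f: a normalized vector
    satisfying Wick's theorem (odd Majorana correlators vanish, even ones
    are the Pfaffian of the two-point contractions). *)
Definition majorana_corr N n (f : 'I_N -> 'M[C]_n) (psi : 'cV[C]_n) m
    (a : 'I_m -> 'I_N * bool) : C :=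
  expect psi (mprod [seq majorana f (a p) | p <- enum 'I_m]).

Definition pure_gaussian N n (f : 'I_N -> 'M[C]_n) (psi : 'cV[C]_n) : Prop :=
  adjm psi *m psi = 1%:M /\
  (forall k (a : 'I_(k.*2).+1 -> 'I_N * bool), majorana_corr f psi a = 0) /\
  (forall k (a : 'I_(k.*2) -> 'I_N * bool),
     majorana_corr f psi a =
     pfaffian (\matrix_(p, q)
        (if (p < q)%N then expect psi (majorana f (a p) *m majorana f (a q))
         else if (q < p)%N then - expect psi (majorana f (a q) *m majorana f (a p))
         else 0))).

(** reduced state on the modes in B: a matrix rho on the Fock space
    C^(2^|B|) of the modes in B (with CAR operators g_j, j in B) reproducing
    all expectation values of the algebra generated by f_j, f_j^dag, j in B. *)
Definition reduced_state N n (f : 'I_N -> 'M[C]_n) (B : {set 'I_N})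
    (psi : 'cV[C]_n) (rho : 'M[C]_(2 ^ #|B|)) : Prop :=
  exists g : 'I_N -> 'M[C]_(2 ^ #|B|), CAR_on B g /\
    forall w : seq ('I_N * bool), all (fun x => x.1 \in B) w ->
      \tr (rho *m word g w) = expect psi (word f w).

Definition is_spectrum n (rho : 'M[C]_n) (d : 'I_n -> R) : Prop :=
  exists U : 'M[C]_n, adjm U *m U = 1%:M /\
    rho = U *m diag_mx (\row_i ((d i)%:C)%C) *m adjm U.

Definition log2 (x : R) : R := ln x / ln 2.

(** Renyi entropy (in units of log 2) of a spectrum; alpha = 1 is von Neumann.
    Zero eigenvalues are omitted (0^alpha = 0, 0 log 0 = 0). *)
Definition renyi_of n (d : 'I_n -> R) (alpha : R) : R :=
  if alpha == 1 then - \sum_(i | d i != 0) d i * log2 (d i)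
  else (1 - alpha)^-1 * log2 (\sum_(i | d i != 0) d i `^ alpha).

Definition renyi_entropy N n (f : 'I_N -> 'M[C]_n) (B : {set 'I_N})
    (psi : 'cV[C]_n) (alpha S : R) : Prop :=
  exists rho d, @reduced_state N n f B psi rho /\ is_spectrum rho d /\
    renyi_of d alpha = S.

Definition hopping_ham N n (f : 'I_N -> 'M[C]_n) (A B : {set 'I_N})
    (h : 'M[C]_N) : 'M[C]_n :=
  let S := \sum_(i in A) \sum_(j in B) h i j *: (adjm (f i) *m f j) in
  S + adjm S.

Definition number_op N n (f : 'I_N -> 'M[C]_n) : 'M[C]_n :=
  \sum_(i < N) adjm (f i) *m f i.

Definition ground_state n (H : 'M[C]_n) (v : 'cV[C]_n) : Prop :=
  v != 0 /\ exists e : C, H *m v = e *: v /\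
    forall (e' : C) (w : 'cV[C]_n), w != 0 -> H *m w = e' *: w -> e <= e'.

End Fermions.

Arguments reduced_state {R N n} f B psi rho.

(* Main.v *)
Require Import Defs.
From mathcomp Require Import all_boot all_order all_algebra all_fingroup.
From mathcomp Require Import spectral ring.
From mathcomp Require Import complex.
From mathcomp Require Import reals exp.
Import Order.TTheory GRing.Theory Num.Theory.
Local Open Scope ring_scope.

(** A singular value decomposition of the A-B block of h gives a unitary change
    of modes, not mixing A and B, after which H is a sum of independent
    two-mode terms sig (a^dag b + b^dag a), with every B mode paired to one A
    mode; the modes (a +- b) / sqrt 2 diagonalize it with energies +- sig.  The
    vector E_s is the common vacuum of the 2^N systems obtained from these
    eigenmodes by exchanging annihilation and creation operators at the
    occupied ones; Wick's theorem holds for every such vacuum.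

    A pair with both eigenmodes occupied, or both empty, leaves its B mode full
    or empty; a pair with one occupied eigenmode leaves its B mode maximally
    mixed.  Hence rho_B is 2^-n(s) times a projector of rank 2^n(s).  To compare
    this operator with E_s no partial trace is computed: both functionals
    satisfy the same KMS-type exchange relations, which fix all moments
    recursively.  Filling the lower eigenmode of every pair gives a ground
    state, because H minus its energy is a sum of sig c^dag c over operators
    c. *)

Set Implicit Arguments. Unset Strict Implicit. Unset Printing Implicit Defensive.

(** Deleting [i0] from the domain and [j0] from the range puts the permutations with [s i0 = j0] in
    bijection with those of one index fewer, as in Laplace expansion. *)
Lemma sum_lift_perm (V : nmodType) n (i0 j0 : 'I_n.+1) (G : 'S_n.+1 -> V) :
  \sum_(s : 'S_n.+1 | s i0 == j0) G s = \sum_(t : 'S_n) G (lift_perm i0 j0 t).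
Proof.
rewrite (reindex (lift_perm i0 j0)); last first.
  pose ulsf i (s : 'S_n.+1) k := odflt k (unlift (s i) (s (lift i k))).
  have ulsfK i (s : 'S_n.+1) k : lift (s i) (ulsf i s k) = s (lift i k).
    rewrite /ulsf; have := neq_lift i k.
    by rewrite -(can_eq (permK s)) => /unlift_some[] ? ? ->.
  have inj_ulsf s : injective (ulsf i0 s).
    apply: can_inj (ulsf (s i0) s^-1%g) _ => k'.
    by rewrite {1}/ulsf ulsfK !permK liftK.
  exists (fun s => perm (inj_ulsf s)) => [s _ | s].
    by apply/permP=> k'; rewrite permE /ulsf lift_perm_lift lift_perm_id liftK.
  move/(s _ =P _) => si0; apply/permP=> k.
  case: (unliftP i0 k) => [k'|] ->; rewrite ?lift_perm_id //.
  by rewrite lift_perm_lift -si0 permE ulsfK.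
by apply: eq_bigl => t; rewrite lift_perm_id eqxx.
Qed.

(** * Pfaffians *)

Section Pfaffian.
Variable R : realType.
Local Notation C := R[i].

Lemma ev_inj k : injective (@ev k).
Proof. by move=> i j /(congr1 val) /= /double_inj /val_inj. Qed.

Lemma od_inj k : injective (@od k).
Proof. by move=> i j /(congr1 val) /= [] /double_inj /val_inj. Qed.

Lemma ev_neq_od k (i j : 'I_k) : (ev i == od j) = false.
Proof. by apply/eqP => /(congr1 (odd \o val)) /=; rewrite !odd_double. Qed.

Lemma ev_or_od k (p : 'I_(k.*2)) : exists i, p = ev i \/ p = od i.
Proof.
have ltp : (p./2 < k)%N by rewrite ltn_half_double.
exists (Ordinal ltp); have := odd_double_half p.
by case: (odd p) => /= eqp; [right | left]; apply: val_inj; rewrite /= -[LHS]eqp.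
Qed.

Definition pf_term k (M : 'M[C]_(k.*2)) (s : 'S_(k.*2)) : C :=
  (-1) ^+ s * \prod_(i < k) M (s (ev i)) (s (od i)).

Definition pair_swap k (i j : 'I_k) : 'S_(k.*2) :=
  (tperm (ev i) (ev j) * tperm (od i) (od j))%g.

Lemma pair_swap_ev k (i j l : 'I_k) : pair_swap i j (ev l) = ev (tperm i j l).
Proof.
by rewrite permM -(inj_tperm _ _ _ (@ev_inj k)) [LHS]tpermD // eq_sym ev_neq_od.
Qed.

Lemma pair_swap_od k (i j l : 'I_k) : pair_swap i j (od l) = od (tperm i j l).
Proof.
by rewrite permM [tperm (ev i) _ _]tpermD ?ev_neq_od // -(inj_tperm _ _ _ (@od_inj k)). Qed.

Lemma pf_term_swap k (M : 'M[C]_(k.*2)) (i j : 'I_k) s :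
  pf_term M (pair_swap i j * s)%g = pf_term M s.
Proof.
rewrite /pf_term odd_permM; congr (_ * _).
  rewrite odd_permM !odd_tperm (inj_eq (@ev_inj k)) (inj_eq (@od_inj k)).
  by rewrite addbb.
rewrite [RHS](reindex_inj (@perm_inj _ (tperm i j))) /=; apply: eq_bigr => l _.
by rewrite -pair_swap_ev -pair_swap_od !(permM (pair_swap i j)).
Qed.

(** The sign of the transposition cancels against the antisymmetry of [M] in the single factor it
    touches. *)
Lemma pf_term_flip k (M : 'M[C]_(k.*2)) (i : 'I_k) s :
  (forall p q, M q p = - M p q) ->
  pf_term M (tperm (ev i) (od i) * s)%g = pf_term M s.
Proof.
move=> antiM; rewrite /pf_term odd_permM odd_tperm ev_neq_od /=.
rewrite (bigD1 i) //= [in RHS](bigD1 i) //= !permM tpermL tpermR antiM.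
rewrite signrN !mulNr mulrN opprK; congr (_ * (_ * _)).
apply: eq_bigr => l li; rewrite !permM !tpermD //.
all: rewrite ?(inj_eq (@ev_inj k)) ?(inj_eq (@od_inj k)) ?ev_neq_od //.
all: by rewrite eq_sym ?ev_neq_od.
Qed.

(* Swapping two pairs, or the two members of a pair, preserves every term, so
   the position sent to [ord0] may be taken to be the first one. *)
Lemma pf_term_pinned k (M : 'M[C]_(k.*2.+2)) (p : 'I_(k.*2.+2)) :
  (forall p q, M q p = - M p q) ->
  \sum_(s : 'S_(k.*2.+2) | s p == ord0) @pf_term k.+1 M s =
  \sum_(s : 'S_(k.*2.+2) | s ord0 == ord0) @pf_term k.+1 M s.
Proof.
move=> antiM.
have evE (i : 'I_k.+1) :
    \sum_(s : 'S_(k.*2.+2) | s (ev i) == ord0) @pf_term k.+1 M s =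
    \sum_(s : 'S_(k.*2.+2) | s ord0 == ord0) @pf_term k.+1 M s.
  rewrite (reindex_inj (mulgI (@pair_swap k.+1 i ord0))) /=.
  apply: eq_big => s; last by rewrite pf_term_swap.
  rewrite permM; congr (s _ == _).
  by rewrite (pair_swap_ev i ord0 i : _ = _ :> 'I_(k.*2.+2)) tpermL; apply: val_inj.
have [i [->|->]] := @ev_or_od k.+1 p; first exact: evE.
rewrite -(evE i) (reindex_inj (mulgI (tperm (ev i) (od i)))) /=.
apply: eq_big => s; last by rewrite pf_term_flip.
by rewrite permM; congr (s _ == _); exact: tpermR.
Qed.

(** Expansion along the first row. All 2(k+1) positions where index 0 can occur contribute alike,
    which turns the denominator 2^(k+1) (k+1)! into 2^k k!; the image of the second position is then
    the partner of 0. *)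
Lemma pfaffian_expand k (M : 'M[C]_(k.*2.+2)) :
  (forall p q, M q p = - M p q) ->
  @pfaffian R k.+1 M =
  \sum_(j < k.*2.+1) (-1) ^+ j * M ord0 (lift ord0 j) *
    @pfaffian R k (\matrix_(p, q) M (lift ord0 (lift j p)) (lift ord0 (lift j q))).
Proof.
move=> antiM; rewrite /pfaffian.
(* Permutations are grouped by the position [p] that holds index 0. *)
rewrite (partition_big (fun s : 'S_(k.*2.+2) => (s^-1)%g ord0) xpredT) //=.
under eq_bigr => p _.
  rewrite (eq_bigl (fun s : 'S_(k.*2.+2) => s p == ord0)); last first.
    by move=> s; rewrite -(can_eq (permK s)) permKV eq_sym.
  rewrite (@pf_term_pinned k M p antiM) sum_lift_perm.
  rewrite (partition_big (fun s : 'S_(k.*2.+1) => s ord0) xpredT) //=.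
  under eq_bigr => j _ do rewrite sum_lift_perm.
  over.
rewrite sumr_const card_ord -[X in _ * X]mulr_natl mulrA.
rewrite mulr_sumr; apply: eq_bigr => j _.
rewrite [RHS]mulrCA; congr (_ * _).
  have -> : k.*2.+2 = (2 * k.+1)%N by rewrite mul2n.
  rewrite expnS factS !natrM; have n0 := @pnatr_eq0 C.
  by field; rewrite nat1r !n0 expn_eq0 -lt0n fact_gt0.
rewrite !mulr_sumr; apply: eq_bigr => t _.
rewrite /pf_term big_ord_recl /= !odd_lift_perm /=.
have -> : ev (ord0 : 'I_k.+1) = ord0 :> 'I_(k.*2.+2) by apply: val_inj.
have -> : od (ord0 : 'I_k.+1) = lift ord0 ord0 :> 'I_(k.*2.+2) by apply: val_inj.
rewrite lift_perm_id lift_perm_lift lift_perm_id.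
rewrite signr_addb signr_odd -!mulrA; congr (_ * _).
rewrite mulrCA; congr (_ * (_ * _)); apply: eq_bigr => i _.
have -> : ev (lift ord0 i) = lift ord0 (lift ord0 (ev i)) :> 'I_(k.*2.+2).
  by apply: val_inj.
have -> : od (lift ord0 i) = lift ord0 (lift ord0 (od i)) :> 'I_(k.*2.+2).
  by apply: val_inj.
by rewrite !lift_perm_lift mxE.
Qed.

End Pfaffian.

(** * Wick's theorem *)

Section Omit.
Variable T : Type.
Implicit Types (s : seq T) (P : pred T).

Definition omit s m := take m s ++ drop m.+1 s.

Lemma size_omit s m : (m < size s)%N -> size (omit s m) = (size s).-1.
Proof.
move=> lt_m; rewrite size_cat size_take size_drop lt_m.
by rewrite subnS -[in RHS](subnKC (ltnW lt_m)) -[RHS]subn1 -addnBA ?subn_gt0 // subn1.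
Qed.

Lemma size_omit_lt s m : (m < size s)%N -> (size (omit s m) < size s)%N.
Proof. by move=> lt_m; rewrite size_omit // prednK // (leq_ltn_trans _ lt_m). Qed.

Lemma all_omit P s m : all P s -> all P (omit s m).
Proof.
elim: s m => [|x s IH] [|m] //= /andP[Px Ps]; first by rewrite /omit /= drop0.
by rewrite Px; exact: IH.
Qed.

(** Translates deletion from a word into [lift], the form in which Pfaffian minors are indexed. *)
Lemma omit_map_enum n (a : 'I_n.+1 -> T) (j : 'I_n.+1) :
  omit [seq a p | p <- enum 'I_n.+1] j = [seq a (lift j p) | p <- enum 'I_n].
Proof.
elim: n a j => [|n IH] a j.
  rewrite enum_ordSl (ord1 j) /= (_ : enum 'I_0 = [::]) //.
  by apply/size0nil/size_enum_ord.
rewrite enum_ordSl map_cons -map_comp.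
case: (unliftP ord0 j) => [j'|] -> /=; last first.
  by rewrite /omit /= drop0; apply: eq_map => p.
rewrite /omit /= -/(omit _ j').
rewrite (IH (a \o lift ord0)) enum_ordSl /= -map_comp; congr (a _ :: _).
  exact: val_inj.
by apply: eq_map => p /=; congr a; apply: val_inj; rewrite /= !bumpS.
Qed.

End Omit.

Section WickRecursion.
Variables (R : realType) (L : Type) (P : pred L) (K : L -> L -> R[i]).
Local Notation C := R[i].

(** Wick's theorem in recursive form: the first letter is contracted with each later one, with the
    sign of bringing them together. The default [x] of [nth] is never reached. *)
Definition wick_rec (phi : seq L -> C) := forall x w, P x -> all P w ->
  phi (x :: w) =
  \sum_(m < size w) (-1) ^+ m * K x (nth x w m) * phi (omit w m).

(** The recursion only calls shorter words, so induction on the length determines everything from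
    the value on the empty word. *)
Lemma wick_rec_unique phi1 phi2 w :
  phi1 [::] = phi2 [::] -> wick_rec phi1 -> wick_rec phi2 -> all P w ->
  phi1 w = phi2 w.
Proof.
move=> phi0 rec1 rec2; have [n] := ubnP (size w).
elim: n w => // n IH [|x w] //= lt_n /andP[Px Pw].
rewrite rec1 // rec2 //; apply: eq_bigr => m _; congr (_ * _).
by rewrite IH ?all_omit // (leq_trans (size_omit_lt (ltn_ord m)) (ltnW lt_n)).
Qed.

(** Two letters disappear at each step, so an odd word is reduced to single letters, where the sum
    is empty. *)
Lemma wick_rec_odd phi w : wick_rec phi -> all P w -> odd (size w) -> phi w = 0.
Proof.
move=> rec; have [n] := ubnP (size w).
elim: n w => // n IH [|x w] //= lt_n /andP[Px Pw] odd_w.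
rewrite rec // big1 // => m _; have lt_m := ltn_ord m.
have w_gt0 : (0 < size w)%N by apply: leq_ltn_trans lt_m.
rewrite IH ?mulr0 ?all_omit // ?(leq_trans (size_omit_lt lt_m) (ltnW lt_n)) //.
rewrite size_omit //.
by rewrite -[size w]prednK // negbK in odd_w.
Qed.

(** The recursion coincides with the expansion of the Pfaffian along its first row. *)
Lemma wick_rec_pfaffian phi k (a : 'I_(k.*2) -> L) :
  wick_rec phi -> phi [::] = 1 -> (forall p, P (a p)) ->
  phi [seq a p | p <- enum 'I_(k.*2)] =
  pfaffian (\matrix_(p, q) (if (p < q)%N then K (a p) (a q)
                            else if (q < p)%N then - K (a q) (a p) else 0)).
Proof.
move=> rec phi0; elim: k a => [|k IH] a Pa.
  rewrite (_ : enum 'I_(0.*2) = [::]) //; last exact/size0nil/size_enum_ord.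
  rewrite phi0 /pfaffian (eq_bigr (fun=> 1)) => [|s _]; last first.
    have -> : s = 1%g by apply/permP => -[].
    by rewrite odd_perm1 expr0 big_ord0 mulr1.
  by rewrite sumr_const card_Sn /= mulr1n mulr1 invr1.
rewrite -[k.+1.*2]/(k.*2.+2) in a Pa *.
rewrite pfaffian_expand => [|p q]; last first.
  rewrite !mxE; case: ltngtP => [//||]; rewrite ?opprK ?oppr0 //.
rewrite enum_ordSl map_cons -map_comp rec ?Pa //; last first.
  by rewrite all_map; apply/allP => p _; apply: Pa.
rewrite size_map size_enum_ord; apply: eq_bigr => j _.
rewrite omit_map_enum (IH (fun p => a (lift ord0 (lift j p)))) //.
rewrite (nth_map ord0) ?size_enum_ord // nth_ord_enum !mxE /=.
congr (_ * pfaffian _); apply/matrixP => p q; rewrite !mxE /=.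
(* Deleting indices preserves their order, so the minor is again [K] above the diagonal and [- K]
   below. *)
rewrite /bump !leq0n !add1n !ltnS.
have lt_bump2 x y : (bump j x < bump j y)%N = (x < y)%N by rewrite !ltnNge leq_bump2.
by rewrite -!/(bump _ _) !lt_bump2.
Qed.

End WickRecursion.

(** * Adjoints and norms *)

Section Adjoint.
Variable R : realType.
Local Notation C := R[i].

Lemma adjmE m n (X : 'M[C]_(m, n)) i j : adjm X i j = (X j i)^*.
Proof. by rewrite !mxE. Qed.

Lemma adjmK m n (X : 'M[C]_(m, n)) : adjm (adjm X) = X.
Proof. by apply/matrixP => i j; rewrite !adjmE conjCK. Qed.

Lemma adjm0 m n : adjm (0 : 'M[C]_(m, n)) = 0.
Proof. by apply/matrixP => i j; rewrite adjmE !mxE conjC0. Qed.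

Lemma adjmD m n (X Y : 'M[C]_(m, n)) : adjm (X + Y) = adjm X + adjm Y.
Proof. by apply/matrixP => i j; rewrite !(adjmE, mxE) rmorphD. Qed.

Lemma adjmN m n (X : 'M[C]_(m, n)) : adjm (- X) = - adjm X.
Proof. by apply/matrixP => i j; rewrite !(adjmE, mxE) rmorphN. Qed.

Lemma adjmZ m n a (X : 'M[C]_(m, n)) : adjm (a *: X) = a^* *: adjm X.
Proof. by apply/matrixP => i j; rewrite !(adjmE, mxE) rmorphM. Qed.

Lemma adjm_sum m n (I : Type) (r : seq I) (P : pred I) (F : I -> 'M[C]_(m, n)) :
  adjm (\sum_(i <- r | P i) F i) = \sum_(i <- r | P i) adjm (F i).
Proof. exact: (big_morph _ (@adjmD m n) (@adjm0 m n)). Qed.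

Lemma adjmM m n p (X : 'M[C]_(m, n)) (Y : 'M[C]_(n, p)) :
  adjm (X *m Y) = adjm Y *m adjm X.
Proof. by rewrite /adjm map_mxM trmx_mul. Qed.

Lemma adjm_scalar n a : adjm (a%:M : 'M[C]_n) = a^*%:M.
Proof. by rewrite /adjm map_scalar_mx tr_scalar_mx. Qed.

Lemma adjm1 n : adjm (1%:M : 'M[C]_n) = 1%:M.
Proof. by rewrite adjm_scalar conjC1. Qed.

Lemma cV_sqnorm_ge0 n (v : 'cV[C]_n) : 0 <= (adjm v *m v) 0 0.
Proof.
by rewrite mxE sumr_ge0 // => i _; rewrite adjmE mulrC mul_conjC_ge0.
Qed.

Lemma cV_sqnorm_eq0 n (v : 'cV[C]_n) : ((adjm v *m v) 0 0 == 0) = (v == 0).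
Proof.
apply/idP/eqP => [|->]; last by rewrite mulmx0 mxE.
rewrite mxE psumr_eq0 => [/allP v0|i _]; last by rewrite adjmE mulrC mul_conjC_ge0.
apply/colP => i; rewrite mxE; apply/eqP; rewrite -mul_conjC_eq0 mulrC.
by have := v0 i (mem_index_enum _); rewrite adjmE.
Qed.

Lemma cV_normalize n (v : 'cV[C]_n) : v != 0 ->
  exists a : C, a != 0 /\ adjm (a *: v) *m (a *: v) = 1%:M.
Proof.
move=> v0; pose q := (adjm v *m v) 0 0.
have q_gt0 : 0 < q by rewrite lt_neqAle eq_sym cV_sqnorm_eq0 v0 cV_sqnorm_ge0.
exists (sqrtC q)^-1; split; first by rewrite invr_eq0 sqrtC_eq0 gt_eqF.
rewrite adjmZ -scalemxAl -scalemxAr scalerA [adjm v *m v]mx11_scalar -/q.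
rewrite scale_scalar_mx; congr (_%:M).
rewrite conj_Creal ?ger0_real ?invr_ge0 ?sqrtC_ge0 ?ltW //.
by rewrite -invfM -expr2 sqrtCK mulVf // gt_eqF.
Qed.

End Adjoint.

(** * Wick expansion in a vacuum *)

Section Wick.
Variable R : realType.
Local Notation C := R[i].

(** [y] is carried through the word from left to right: passing a letter costs a sign and leaves the
    scalar [a] with that letter deleted. *)
Lemma wick_step n (L : Type) (P : pred L) (F : L -> 'M[C]_n) (a : L -> C)
    (y : 'M[C]_n) (l0 : L) (w : seq L) :
  (forall l, P l -> y *m F l + F l *m y = (a l)%:M) -> all P w ->
  y *m mprod (map F w) =
  \sum_(m < size w) ((-1) ^+ m * a (nth l0 w m)) *: mprod (map F (omit w m))
  + (-1) ^+ size w *: (mprod (map F w) *m y).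
Proof.
move=> anti; elim: w => [|l w IH] /=.
  by rewrite big_ord0 add0r expr0 scale1r mulmx1 mul1mx.
move=> /andP[Pl Pw]; rewrite mulmxA -[y *m F l](addrK (F l *m y)) anti //.
rewrite mulmxBl -[F l *m y *m _]mulmxA IH // mul_scalar_mx big_ord_recl /= expr0 mul1r.
rewrite [in RHS](_ : omit (l :: w) 0 = w) ?[omit _ _]drop0 // -addrA; congr (_ + _).
rewrite mulmxDr opprD mulmx_sumr -sumrN -scalemxAr mulmxA exprS mulN1r scaleNr.
congr (_ + _); apply: eq_bigr => m _.
by rewrite -scalemxAr -scaleNr -mulNr exprS mulN1r.
Qed.

Lemma expect_mulmx n (psi : 'cV[C]_n) (X Y : 'M[C]_n) :
  expect psi (X *m Y) = (adjm (adjm X *m psi) *m (Y *m psi)) 0 0.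
Proof. by rewrite /expect adjmM adjmK !mulmxA. Qed.

Lemma expectE n (psi : 'cV[C]_n) (X : 'M[C]_n) :
  expect psi X = \tr (psi *m adjm psi *m X).
Proof. by rewrite -mulmxA mxtrace_mulC /expect /mxtrace big_ord1. Qed.

Lemma expectD n (psi : 'cV[C]_n) (X Y : 'M[C]_n) :
  expect psi (X + Y) = expect psi X + expect psi Y.
Proof. by rewrite !expectE mulmxDr mxtraceD. Qed.

Lemma expectZ n (psi : 'cV[C]_n) a (X : 'M[C]_n) :
  expect psi (a *: X) = a * expect psi X.
Proof. by rewrite !expectE -scalemxAr mxtraceZ. Qed.

Lemma expect_sum n (psi : 'cV[C]_n) (I : Type) (r : seq I) (P : pred I)
    (F : I -> 'M[C]_n) :
  expect psi (\sum_(i <- r | P i) F i) = \sum_(i <- r | P i) expect psi (F i).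
Proof.
by rewrite expectE mulmx_sumr raddf_sum; apply: eq_bigr => i _; rewrite expectE. Qed.

Lemma expect_scalar n (psi : 'cV[C]_n) a :
  adjm psi *m psi = 1%:M -> expect psi a%:M = a.
Proof. by move=> psi1; rewrite /expect mul_mx_scalar -scalemxAl psi1 !mxE mulr1. Qed.

Lemma expect_annihil_r n (psi : 'cV[C]_n) (X Y : 'M[C]_n) :
  Y *m psi = 0 -> expect psi (X *m Y) = 0.
Proof. by move=> Y0; rewrite expect_mulmx Y0 mulmx0 mxE. Qed.

Lemma expect_annihil_l n (psi : 'cV[C]_n) (X Y : 'M[C]_n) :
  adjm X *m psi = 0 -> expect psi (X *m Y) = 0.
Proof. by move=> X0; rewrite expect_mulmx X0 adjm0 mul0mx mxE. Qed.

(** With [F x] leftmost, its creating part [Y] vanishes against the bra, and its annihilating part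
    [X] is carried to the right until it kills [psi]; the contractions remain. *)
Lemma vacuum_wick_rec n (L : Type) (P : pred L) (F : L -> 'M[C]_n) (psi : 'cV[C]_n) :
  adjm psi *m psi = 1%:M ->
  (forall x, P x -> exists X Y, [/\ F x = X + Y, X *m psi = 0, adjm Y *m psi = 0 &
     forall y, P y -> exists c : C, X *m F y + F y *m X = c%:M]) ->
  wick_rec P (fun x y => expect psi (F x *m F y))
    (fun w => expect psi (mprod (map F w))).
Proof.
move=> psi1 split x w Px Pw; have [X [Y [eqF Xpsi Ypsi anti]]] := split x Px.
have FxE Z : expect psi (F x *m Z) = expect psi (X *m Z).
  by rewrite eqF mulmxDl expectD [X in _ + X]expect_annihil_l ?addr0.
(* A scalar anticommutator equals its own expectation, where the term ending in [X] vanishes; hence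
   it is the two-point function. *)
have antiE y : P y -> X *m F y + F y *m X = (expect psi (F x *m F y))%:M.
  move=> /anti[c cE]; rewrite FxE cE; congr (_%:M).
  move/(congr1 (expect psi)): cE; rewrite expectD expect_scalar //.
  by rewrite [X in _ + X]expect_annihil_r // addr0.
rewrite /= FxE (wick_step x antiE Pw) expectD expectZ.
rewrite [X in _ + _ * X]expect_annihil_r // mulr0 addr0 expect_sum.
by apply: eq_bigr => m _; rewrite expectZ.
Qed.

End Wick.

(** * Anticommutation relations and changes of modes *)

Section Fermions.
Variable R : realType.
Local Notation C := R[i].

Definition acomm n (X Y : 'M[C]_n) := X *m Y + Y *m X.

Lemma acommC n (X Y : 'M[C]_n) : acomm X Y = acomm Y X.
Proof. exact: addrC. Qed.

Lemma acommDl n (X Y Z : 'M[C]_n) : acomm (X + Y) Z = acomm X Z + acomm Y Z.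
Proof. by rewrite /acomm mulmxDl mulmxDr addrACA. Qed.

Lemma acommZl n a (X Y : 'M[C]_n) : acomm (a *: X) Y = a *: acomm X Y.
Proof. by rewrite /acomm -scalemxAl -scalemxAr scalerDr. Qed.

Lemma acommZr n a (X Y : 'M[C]_n) : acomm X (a *: Y) = a *: acomm X Y.
Proof. by rewrite acommC acommZl acommC. Qed.

Lemma acomm0l n (X : 'M[C]_n) : acomm 0 X = 0.
Proof. by rewrite /acomm mul0mx mulmx0 addr0. Qed.

Lemma acomm_suml n (I : Type) (r : seq I) (P : pred I) (F : I -> 'M[C]_n) Y :
  acomm (\sum_(i <- r | P i) F i) Y = \sum_(i <- r | P i) acomm (F i) Y.
Proof. by rewrite /acomm mulmx_suml mulmx_sumr big_split. Qed.

Lemma acomm_sumr n (I : Type) (r : seq I) (P : pred I) (F : I -> 'M[C]_n) Y :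
  acomm Y (\sum_(i <- r | P i) F i) = \sum_(i <- r | P i) acomm Y (F i).
Proof. by rewrite acommC acomm_suml; under eq_bigr do rewrite acommC. Qed.

Lemma acomm_adj n (X Y : 'M[C]_n) : acomm (adjm X) (adjm Y) = adjm (acomm X Y).
Proof. by rewrite /acomm adjmD !adjmM addrC. Qed.

Lemma acomm_eq0 n (X Y : 'M[C]_n) : acomm X Y = 0 -> X *m Y = - (Y *m X).
Proof. by move=> XY; apply/eqP; rewrite -addr_eq0 -/(acomm X Y) XY. Qed.

Section Modes.
Variables (N n : nat) (S : {set 'I_N}) (g : 'I_N -> 'M[C]_n).

Lemma adjm_fop x : adjm (fop g x) = fop g (x.1, ~~ x.2).
Proof. by case: x => j [] //=; rewrite /fop /= adjmK. Qed.

Lemma CAR_fop : CAR_on S g -> forall x y, x.1 \in S -> y.1 \in S ->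
  acomm (fop g x) (fop g y) = ((x.1 == y.1) && (x.2 != y.2))%:R%:M.
Proof.
move=> car [i b] [j c] /= Si Sj; have [ij1 ij2] := car i j Si Sj.
have [ji1 _] := car j i Sj Si.
case: b c => -[]; rewrite /fop /= ?andbT ?andbF ?raddf0 //.
- by rewrite acomm_adj /acomm ij2 adjm0.
- by rewrite acommC eq_sym.
Qed.

(** Particle-hole exchange at the occupied modes: a vector killed by [flip s k] has occupation [s k]
    in mode [k]. *)
Definition flip (s : 'I_N -> bool) k := fop g (k, s k).

Lemma CAR_flip s : CAR_on S g -> CAR_on S (flip s).
Proof.
move=> car i j Si Sj; rewrite adjm_fop.
split; last first.
  by rewrite -/(acomm _ _) CAR_fop //=; case: eqP => [->|]; rewrite ?eqxx ?raddf0.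
by rewrite -/(acomm _ _) CAR_fop //=; case: (i =P j) => [->|] //; case: (s j).
Qed.

(** Modes are treated one at a time from any nonzero vector: if [g i] does not kill [v], pass to
    [g i *m v], which [g i] kills because its square is 0; anticommutation preserves what was
    achieved before. *)
Lemma CAR_vacuum : CAR_on S g -> (0 < n)%N ->
  exists v : 'cV[C]_n, adjm v *m v = 1%:M /\ forall k, k \in S -> g k *m v = 0.
Proof.
move=> car n_gt0.
have [v [v0 vS]] : exists v : 'cV[C]_n, v != 0 /\
    forall k, k \in enum S -> g k *m v = 0.
  have : {subset enum S <= S} by move=> k; rewrite mem_enum.
  elim: (enum S) => [|i l IH] sub_l.
    exists (const_mx 1); split=> //; apply/eqP => /colP/(_ (Ordinal n_gt0)).
    by rewrite !mxE => /eqP; rewrite oner_eq0.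
  have [k lk|v [v0 vl]] := IH; first by rewrite sub_l // inE lk orbT.
  have Si : i \in S by rewrite sub_l ?mem_head.
  have anti j : j \in S -> g j *m g i = - (g i *m g j).
    by move=> Sj; apply: acomm_eq0; case: (car j i Sj Si).
  have [iv0|iv_neq0] := eqVneq (g i *m v) 0.
    by exists v; split=> // k; rewrite inE => /predU1P[->|/vl].
  exists (g i *m v); split=> // k; rewrite inE => /predU1P[->|lk].
    have /eqP := anti i Si; rewrite -addr_eq0 -mulr2n -scaler_nat scaler_eq0.
    by rewrite pnatr_eq0 /= => /eqP gg; rewrite mulmxA gg mul0mx.
  by rewrite mulmxA anti ?sub_l ?inE ?lk ?orbT // mulNmx -mulmxA vl // mulmx0 oppr0.
have [a [a0 av1]] := cV_normalize v0.
by exists (a *: v); split=> // k Sk; rewrite -scalemxAr vS ?mem_enum // scaler0.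
Qed.

(** Unitarity of the block of [V] on [S], by columns and by rows, without forming a submatrix. *)
Definition unitary_on (V : 'M[C]_N) :=
  (forall k l, k \in S -> l \in S -> \sum_(j in S) (V j k)^* * V j l = (k == l)%:R) /\
  (forall i j, i \in S -> j \in S -> \sum_(k in S) V i k * (V j k)^* = (i == j)%:R).

(** Column [k] of [V] is the wave function of the mode; it enters the creation operator
    unconjugated, hence the conjugate here. *)
Definition mode (V : 'M[C]_N) k := \sum_(j in S) (V j k)^* *: g j.

Definition cj (b : bool) (z : C) := if b then z^* else z.

Lemma fop_mode V k b :
  fop (mode V) (k, b) = \sum_(j in S) cj (~~ b) (V j k) *: fop g (j, b).
Proof.
rewrite /fop /mode /=; case: b => //; rewrite adjm_sum; apply: eq_bigr => j _.
by rewrite adjmZ conjCK.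
Qed.

Lemma acomm_mode V : CAR_on S g -> forall k b x, x.1 \in S ->
  acomm (fop (mode V) (k, b)) (fop g x) = ((b != x.2)%:R * cj (~~ b) (V x.1 k))%:M.
Proof.
move=> car k b x Sx; rewrite fop_mode acomm_suml (bigD1 x.1) //=.
rewrite big1 => [|j /andP[Sj jx]].
  by rewrite acommZl CAR_fop //= eqxx scale_scalar_mx addr0 mulrC.
by rewrite acommZl CAR_fop //= (negbTE jx) raddf0 scaler0.
Qed.

Lemma CAR_mode V : CAR_on S g -> unitary_on V -> CAR_on S (mode V).
Proof.
move=> car [uV _] k l Sk Sl; split; rewrite -/(acomm _ _).
  rewrite -[adjm _]/(fop (mode V) (l, true)) -[mode V k]/(fop (mode V) (k, false)).
  rewrite [fop _ (l, _)]fop_mode acomm_sumr -uV // raddf_sum; apply: eq_bigr => j Sj.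
  by rewrite acommZr acomm_mode //= scale_scalar_mx mul1r mulrC.
rewrite -[mode V l]/(fop (mode V) (l, false)) -[mode V k]/(fop (mode V) (k, false)).
rewrite [fop _ (l, _)]fop_mode acomm_sumr big1 // => j Sj.
by rewrite acommZr acomm_mode //= mul0r raddf0 scaler0.
Qed.

Lemma fop_modeK V : unitary_on V -> forall x, x.1 \in S ->
  fop g x = \sum_(k in S) cj x.2 (V x.1 k) *: fop (mode V) (k, x.2).
Proof.
move=> [_ uV] [i b] /= Si; under eq_bigr do rewrite fop_mode scaler_sumr.
rewrite exchange_big /= (bigD1 i) //= [X in _ + X]big1 => [|j /andP[Sj ji]].
  rewrite addr0; under eq_bigr do rewrite scalerA.
  rewrite -scaler_suml; case: b => /=; last by rewrite uV // eqxx scale1r.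
  by under eq_bigr do rewrite mulrC; rewrite uV // eqxx scale1r.
under eq_bigr do rewrite scalerA.
rewrite -scaler_suml; case: b => /=; last by rewrite uV // eq_sym (negbTE ji) scale0r.
by under eq_bigr do rewrite mulrC; rewrite uV // (negbTE ji) scale0r.
Qed.

End Modes.
End Fermions.

(** * Vacua of rotated and flipped modes are Gaussian *)

Section Gaussian.
Variable R : realType.
Local Notation C := R[i].
Variables (N n : nat) (f : 'I_N -> 'M[C]_n).

(** Annihilating and creating parts relative to [psi]. The property is stable under linear
    combinations, so it only has to be checked on single mode operators. *)
Definition vac_split (psi : 'cV[C]_n) (Z : 'M[C]_n) := exists X Y,
  [/\ Z = X + Y, X *m psi = 0, adjm Y *m psi = 0 &
      forall x, exists c : C, acomm X (fop f x) = c%:M].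

Lemma vac_splitD psi Z1 Z2 :
  vac_split psi Z1 -> vac_split psi Z2 -> vac_split psi (Z1 + Z2).
Proof.
move=> [X1 [Y1 [-> X10 Y10 a1]]] [X2 [Y2 [-> X20 Y20 a2]]].
exists (X1 + X2), (Y1 + Y2); split; first by rewrite addrACA.
- by rewrite mulmxDl X10 X20 addr0.
- by rewrite adjmD mulmxDl Y10 Y20 addr0.
move=> x; have [c1 e1] := a1 x; have [c2 e2] := a2 x.
by exists (c1 + c2); rewrite acommDl e1 e2 raddfD.
Qed.

Lemma vac_splitZ psi a Z : vac_split psi Z -> vac_split psi (a *: Z).
Proof.
move=> [X [Y [-> X0 Y0 aX]]]; exists (a *: X), (a *: Y); split.
- by rewrite scalerDr.
- by rewrite -scalemxAl X0 scaler0.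
- by rewrite adjmZ -scalemxAl Y0 scaler0.
by move=> x; have [c e] := aX x; exists (a * c); rewrite acommZl e scale_scalar_mx.
Qed.

Lemma vac_split_sum psi (I : Type) (r : seq I) (P : pred I) (F : I -> 'M[C]_n) :
  (forall i, P i -> vac_split psi (F i)) ->
  vac_split psi (\sum_(i <- r | P i) F i).
Proof.
move=> FP; apply: big_ind => //; last exact: vac_splitD.
exists 0, 0; split; rewrite ?addr0 ?adjm0 ?mul0mx // => x.
by exists 0; rewrite acomm0l raddf0.
Qed.

Lemma majoranaE x : exists a b : C,
  majorana f x = a *: fop f (x.1, false) + b *: fop f (x.1, true).
Proof.
case: x => j [] /=; last by exists 1, 1; rewrite !scale1r.
by exists (- 'i%C), ('i%C); rewrite /majorana /fop /= scalerBr scaleNr addrC.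
Qed.

Lemma gaussian_vacuum (V : 'M[C]_N) (s : 'I_N -> bool) (psi : 'cV[C]_n) :
  CAR f -> unitary_on [set: 'I_N] V -> adjm psi *m psi = 1%:M ->
  (forall k, flip (mode [set: 'I_N] f V) s k *m psi = 0) ->
  pure_gaussian f psi.
Proof.
move=> car uV psi1 vac.
have split_maj x : vac_split psi (majorana f x).
  have split_fop y : vac_split psi (fop f y).
    rewrite (fop_modeK f uV) ?inE //; apply: vac_split_sum => k _.
    apply: vac_splitZ; set Z := fop _ _.
    have aZ z : exists c : C, acomm Z (fop f z) = c%:M.
      by eexists; rewrite /Z acomm_mode ?inE.
    (* A mode operator lies wholly in one part: it is either the one that kills [psi] or its
       adjoint. *)
    have [yk|yk] := eqVneq y.2 (s k).
      exists Z, 0; rewrite addr0 adjm0 mul0mx; split=> //.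
      by rewrite /Z yk; exact: vac.
    exists 0, Z; rewrite add0r mul0mx /Z adjm_fop /=; split=> // [|z].
      by rewrite (_ : ~~ y.2 = s k); [exact: vac | case: (y.2) (s k) yk => [] []].
    by exists 0; rewrite acomm0l raddf0.
  by have [a [b ->]] := majoranaE x; apply: vac_splitD; apply: vac_splitZ.
have rec : wick_rec predT (fun x y => expect psi (majorana f x *m majorana f y))
    (fun w => expect psi (mprod (map (majorana f) w))).
  apply: vacuum_wick_rec => // x _; have [X [Y [eqZ X0 Y0 aX]]] := split_maj x.
  exists X, Y; split=> // y _; have [a [b ->]] := majoranaE y.
  have [c1 e1] := aX (y.1, false); have [c2 e2] := aX (y.1, true).
  exists (a * c1 + b * c2); rewrite -/(acomm _ _) acommC acommDl !acommZl.
  by rewrite ![acomm _ X]acommC e1 e2 !scale_scalar_mx raddfD.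
split=> //; split=> k a; rewrite /majorana_corr map_comp.
  apply: (wick_rec_odd rec); rewrite ?all_predT //.
  by rewrite size_map size_enum_ord /= odd_double.
by apply: (wick_rec_pfaffian rec) => //=; rewrite expect_scalar.
Qed.

End Gaussian.

(** * Functionals determined by exchange relations *)

Section QuasiFree.
Variable R : realType.
Local Notation C := R[i].
Variables (N : nat) (S : {set 'I_N}) (V : 'M[C]_N) (lam : 'I_N * bool -> C).

Definition in_modes : pred ('I_N * bool) := fun x => x.1 \in S.

(* KMS-type condition: lam = 0 or 1 when the mode operator kills rho from one
   side, lam = 1/2 when it acts as under a graded trace. *)
Definition kms n (g : 'I_N -> 'M[C]_n) (rho : 'M[C]_n) :=
  forall k b w, k \in S -> all in_modes w ->
    (1 - lam (k, b)) * \tr (rho *m (fop (mode S g V) (k, b) *m word g w)) =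
    - ((-1) ^+ size w * lam (k, b) * \tr (rho *m (word g w *m fop (mode S g V) (k, b)))).

(** The exchange relation makes the moment equal to [lam] times that of a graded commutator, which
    [wick_step] expands into contractions. *)
Lemma kms_wick_rec n (g : 'I_N -> 'M[C]_n) rho :
  CAR_on S g -> unitary_on S V -> kms g rho ->
  wick_rec in_modes
    (fun x y => \sum_(k in S) cj x.2 (V x.1 k) * lam (k, x.2) *
       ((x.2 != y.2)%:R * cj (~~ x.2) (V y.1 k)))
    (fun w => \tr (rho *m word g w)).
Proof.
move=> car uV kmsg x w Sx Sw; rewrite /word /= -/(word g w) (fop_modeK g uV) //.
rewrite mulmx_suml mulmx_sumr raddf_sum /=.
under [RHS]eq_bigr do rewrite /= -mulrA mulrCA mulr_suml.
rewrite [RHS]exchange_big /=; apply: eq_bigr => k Sk.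
rewrite -scalemxAl -scalemxAr mxtraceZ.
have step := @wick_step _ n _ in_modes (fop g) _ _ x w
  (fun y Sy => acomm_mode V car k x.2 Sy) Sw.
have := kmsg k x.2 w Sk Sw; set T := \tr _ => eqT.
(* Adding [lam] times [T] to both sides of the relation produces the graded commutator. *)
have {eqT}-> : T = lam (k, x.2) * (T - (-1) ^+ size w *
    \tr (rho *m (word g w *m fop (mode S g V) (k, x.2)))).
  by rewrite mulrBr mulrCA mulrA -[X in _ - X]opprK -eqT; ring.
rewrite /T -/(word g w) step mulmxDr mxtraceD -scalemxAr mxtraceZ addrK.
rewrite mulmx_sumr raddf_sum !mulr_sumr; apply: eq_bigr => m _ /=.
rewrite -scalemxAr mxtraceZ -/(word g _); ring.
Qed.

(** The contraction kernel depends only on [V] and [lam], so operators on spaces of different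
    dimension have the same moments once their traces agree. *)
Lemma kms_unique n n' (g : 'I_N -> 'M[C]_n) (g' : 'I_N -> 'M[C]_n') rho rho' w :
  CAR_on S g -> CAR_on S g' -> unitary_on S V ->
  kms g rho -> kms g' rho' -> \tr rho = \tr rho' -> all in_modes w ->
  \tr (rho *m word g w) = \tr (rho' *m word g' w).
Proof.
move=> car car' uV kmsg kmsg' tr_eq.
apply: (wick_rec_unique (phi1 := fun w => \tr (rho *m word g w))
  (phi2 := fun w => \tr (rho' *m word g' w)) _
  (kms_wick_rec car uV kmsg) (kms_wick_rec car' uV kmsg')).
by rewrite !mulmx1.
Qed.

End QuasiFree.

(** * Jordan-Wigner representation *)

Section JordanWigner.
Variable R : realType.
Local Notation C := R[i].

Lemma adjm_block m n (X : 'M[C]_m) (Y : 'M[C]_(m, n)) (Z : 'M[C]_(n, m)) (T : 'M[C]_n) :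
  adjm (block_mx X Y Z T) = block_mx (adjm X) (adjm Z) (adjm Y) (adjm T).
Proof. by rewrite /adjm map_block_mx tr_block_mx. Qed.

(** Induction on [S]: a new mode doubles the space, and the parity [G] in its off-diagonal block
    makes it anticommute with the old modes. The parity is returned for the induction and for later
    use on odd traces. *)
Lemma exists_CAR N (S : {set 'I_N}) n : n = (2 ^ #|S|)%N ->
  exists (g : 'I_N -> 'M[C]_n) (G : 'M[C]_n),
    [/\ CAR_on S g, adjm G = G, G *m G = 1%:M &
        forall j, j \in S -> G *m g j = - (g j *m G)].
Proof.
have [k] := ubnP #|S|; elim: k S n => // k IH S n lt_k.
have [->|[i Si]] := set_0Vmem S.
  move=> _; exists (fun=> 0), 1%:M; split; rewrite ?adjm1 ?mulmx1 // => i.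
    by move=> j; rewrite inE.
  by rewrite inE.
rewrite (cardsD1 i) Si add1n expnS mul2n -addnn.
have [|g [G [car adjG GG Gg]]] := IH (S :\ i) (2 ^ #|S :\ i|)%N _ (erefl _).
  by rewrite (cardsD1 i) Si in lt_k.
move=> {n}->; set n := (2 ^ _)%N in g G car adjG GG Gg *.
pose g' j : 'M[C]_(n + n) :=
  if j == i then block_mx 0 G 0 0 else block_mx (g j) 0 0 (g j).
have Gadj j : j \in S :\ i -> G *m adjm (g j) = - (adjm (g j) *m G).
  by move=> Sj; rewrite -[G in LHS]adjG -adjmM -[g j *m G]opprK -Gg // adjmN adjmM adjG.
(* The new mode changes the parity, hence the opposite sign on the second summand. *)
exists g', (block_mx G 0 0 (- G)); split.
- move=> p q Sp Sq; rewrite /g'.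
  have [->|pi] := eqVneq p i; have [qi|qi] := eqVneq q i; rewrite ?qi ?eqxx.
  + rewrite !adjm_block !adjm0 adjG !mulmx_block !add_block_mx.
    by rewrite !(mul0mx, mulmx0, addr0, add0r) GG -scalar_mx_block block_mx0.
  + have Sq' : q \in S :\ i by rewrite !inE qi.
    rewrite !adjm_block !adjm0 !mulmx_block !add_block_mx.
    rewrite !(mul0mx, mulmx0, addr0, add0r) Gg // Gadj // !addNr block_mx0.
    by rewrite raddf0.
  + have Sp' : p \in S :\ i by rewrite !inE pi.
    rewrite !adjm_block !adjm0 adjG !mulmx_block !add_block_mx.
    rewrite !(mul0mx, mulmx0, addr0, add0r) Gg // !subrr block_mx0.
    by rewrite (negbTE pi) raddf0.
  have Sp' : p \in S :\ i by rewrite !inE pi.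
  have Sq' : q \in S :\ i by rewrite !inE qi.
  have [e1 e2] := car p q Sp' Sq'.
  rewrite !adjm_block !adjm0 !mulmx_block !add_block_mx.
  by rewrite !(mul0mx, mulmx0, addr0, add0r) e1 e2 -scalar_mx_block block_mx0.
- by rewrite adjm_block !adjm0 adjmN adjG.
- rewrite mulmx_block !(mul0mx, mulmx0, addr0, add0r) mulNmx mulmxN opprK GG.
  by rewrite -scalar_mx_block.
move=> j Sj; rewrite /g'; have [_|ji] := eqVneq j i.
  rewrite !mulmx_block !(mul0mx, mulmx0, addr0, add0r) opp_block_mx.
  by rewrite !mulmxN !oppr0 opprK.
rewrite !mulmx_block !(mul0mx, mulmx0, addr0, add0r) opp_block_mx !oppr0.
by rewrite mulNmx mulmxN Gg ?opprK // !inE ji.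
Qed.

End JordanWigner.

(** * Normal form of the hopping matrix *)

Section Diagonalization.
Variable R : realType.
Local Notation C := R[i].

Lemma adjm_mulE m n p (X : 'M[C]_(m, n)) (Y : 'M[C]_(m, p)) i j :
  (adjm X *m Y) i j = \sum_k (X k i)^* * Y k j.
Proof. by rewrite mxE; apply: eq_bigr => k _; rewrite adjmE. Qed.

Lemma hermitian_spectral n (K : 'M[C]_n) : adjm K = K ->
  exists (U : 'M[C]_n) (d : 'I_n -> C), adjm U *m U = 1%:M /\
    K = U *m diag_mx (\row_i d i) *m adjm U.
Proof.
move=> hermK; have normK : K \is normalmx.
  by apply/normalmxP; rewrite -map_trmx -/(adjm K) hermK.
have unP := spectral_unitarymx K.
exists (adjm (spectralmx K)), (spectral_diag K 0); split.
  rewrite adjmK; move/unitarymxP: unP => <-; congr (_ *m _).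
  by apply/matrixP => i j; rewrite !mxE.
rewrite adjmK [LHS](orthomx_spectralP normK) invmx_unitary //.
congr (_ *m diag_mx _ *m _); last by apply/rowP => i; rewrite mxE.
by apply/matrixP => i j; rewrite !mxE.
Qed.

(** One column at a time: with the columns outside [S] set to 0 the matrix is singular, and the
    normalized adjoint of a left null vector is orthogonal to the columns kept. *)
Lemma extend_orthonormal N (S : {set 'I_N}) (Y : 'M[C]_N) :
  (forall k l, k \in S -> l \in S -> (adjm Y *m Y) k l = (k == l)%:R) ->
  exists U : 'M[C]_N, adjm U *m U = 1%:M /\ forall i k, k \in S -> U i k = Y i k.
Proof.
have [m] := ubnP #|~: S|; elim: m S Y => // m IH S Y lt_m orthoY.
have [S_full|[k0]] := set_0Vmem (~: S).
  exists Y; split=> //; apply/matrixP => k l; rewrite orthoY ?mxE //.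
    by rewrite -[S]setCK S_full setC0 inE.
  by rewrite -[S]setCK S_full setC0 inE.
rewrite inE => k0S; pose Z := \matrix_(i, k) (if k \in S then Y i k else 0).
have : \det Z == 0.
  by rewrite (expand_det_col _ k0) big1 // => i _; rewrite mxE (negbTE k0S) mul0r.
case/det0P=> v v0 vZ; have : adjm v != 0.
  by apply: contraNneq v0 => v'0; rewrite -[v]adjmK v'0 adjm0.
case/cV_normalize=> a [_]; set x := a *: adjm v => x1.
have xY k : k \in S -> (adjm x *m Y) 0 k = 0.
  move=> Sk; rewrite /x adjmZ adjmK -scalemxAl mxE.
  suff -> : (v *m Y) 0 k = (v *m Z) 0 k by rewrite vZ mxE mulr0.
  by rewrite !mxE; apply: eq_bigr => i _; rewrite mxE Sk.
pose Y' := \matrix_(i, k) (if k == k0 then x i 0 else Y i k).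
have [|k l|U [U1 UY']] := IH (k0 |: S) Y'.
- by rewrite (cardsD1 k0) inE k0S in lt_m; rewrite setCU setIC -setDE.
- rewrite !in_setU1 => kS lS; rewrite adjm_mulE.
  have [->|kk0] := eqVneq k k0; have [->|lk0] := eqVneq l k0; rewrite ?eqxx.
  + move/matrixP/(_ 0 0): x1; rewrite adjm_mulE !mxE => <-.
    by apply: eq_bigr => i _; rewrite !mxE eqxx.
  + rewrite (negbTE lk0) /= in lS; rewrite -[RHS](xY l lS) adjm_mulE.
    by apply: eq_bigr => i _; rewrite !mxE eqxx (negbTE lk0).
  + rewrite (negbTE kk0) /= in kS; rewrite (negbTE kk0) -[RHS]conjC0.
    rewrite -[X in _ = X^*](xY k kS) adjm_mulE rmorph_sum.
    by apply: eq_bigr => i _; rewrite !mxE eqxx (negbTE kk0) rmorphM /= conjCK mulrC.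
  rewrite (negbTE kk0) /= in kS; rewrite (negbTE lk0) /= in lS.
  rewrite -(orthoY k l kS lS) adjm_mulE; apply: eq_bigr => i _.
  by rewrite !mxE (negbTE kk0) (negbTE lk0).
exists U; split=> // i k Sk; rewrite UY' ?inE ?Sk ?orbT // mxE.
by case: eqP Sk k0S => // -> ->.
Qed.

(** Spectral theorem for the block of [K] on [B], transported along the enumeration of [B] and
    padded with zeros. *)
Lemma hermitian_block_spectral N (B : {set 'I_N}) (K : 'M[C]_N) : adjm K = K ->
  exists (V : 'M[C]_N) (d : 'I_N -> C),
    [/\ forall i k, i \notin B -> V i k = 0,
        forall k l, k \in B -> l \in B -> (adjm V *m V) k l = (k == l)%:R &
        forall k l, k \in B -> l \in B -> (adjm V *m K *m V) k l = (k == l)%:R * d k].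
Proof.
(* [enum_rank_in] needs an element of [B], so the empty set is treated apart. *)
move=> hermK; have [->|[b0 Bb0]] := set_0Vmem B.
  by exists 0, (fun=> 0); split=> [i k _|k l|k l]; rewrite ?mxE ?inE.
pose K' := \matrix_(a < #|B|, b < #|B|) K (enum_val a) (enum_val b).
have hermK' : adjm K' = K'.
  by apply/matrixP => a b; rewrite adjmE !mxE -[K in RHS]hermK adjmE.
have [U [d [U1 UK]]] := hermitian_spectral hermK'.
pose rk := enum_rank_in Bb0.
pose V := \matrix_(i, k) (if i \in B then U (rk i) (rk k) else 0).
have VE (a : 'I_#|B|) k : V (enum_val a) k = U a (rk k).
  by rewrite mxE enum_valP /rk enum_valK_in.
have sumV (F : 'I_N -> C) : (forall i, i \notin B -> F i = 0) ->
    \sum_i F i = \sum_(a < #|B|) F (enum_val a).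
  by move=> F0; rewrite -big_enum_val [LHS](bigID (mem B)) /= [X in _ + X]big1 ?addr0.
have rk_inj k l : k \in B -> l \in B -> (rk k == rk l) = (k == l).
  by move=> Bk Bl; apply/eqP/eqP => [|->] //; apply: enum_rank_in_inj.
exists V, (fun k => d (rk k)); split.
- by move=> i k iB; rewrite mxE (negbTE iB).
- move=> k l Bk Bl; rewrite adjm_mulE sumV => [|i iB]; last first.
    by rewrite !mxE (negbTE iB) mulr0.
  under eq_bigr do rewrite !VE.
  by rewrite -adjm_mulE U1 mxE rk_inj.
move=> k l Bk Bl.
transitivity ((adjm U *m K' *m U) (rk k) (rk l)).
  rewrite mxE sumV => [|i iB]; last by rewrite [V _ _]mxE (negbTE iB) mulr0.
  rewrite mxE; apply: eq_bigr => b _; rewrite VE; congr (_ * _).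
  rewrite !adjm_mulE sumV => [|i iB]; last first.
    by rewrite [V _ _]mxE (negbTE iB) conjC0 mul0r.
  by apply: eq_bigr => a _; rewrite VE [K' _ _]mxE.
rewrite UK !mulmxA U1 mul1mx -mulmxA U1 mulmx1 !mxE rk_inj // eq_sym.
by rewrite mulr_natl.
Qed.

End Diagonalization.

(** Elements of [B] are matched with those of [A] of the same rank in the enumeration; the rest of
    [A] is fixed. *)
Lemma exists_pairing (T : finType) (A B : {set T}) :
  A :&: B = set0 -> A :|: B = [set: T] -> (#|B| <= #|A|)%N ->
  exists theta : T -> T, [/\ involutive theta,
    forall k, k \in B -> theta k \notin B &
    forall l, l \notin B -> theta l \notin B -> theta l = l].
Proof.
move=> AB0 ABT leBA.
have AC k : (k \in A) = (k \notin B).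
  move/setP/(_ k): AB0; move/setP/(_ k): ABT; rewrite !inE.
  by case: (k \in A); case: (k \in B).
pose th k := if k \in B then nth k (enum A) (index k (enum B)) else
  if (index k (enum A) < #|B|)%N then nth k (enum B) (index k (enum A)) else k.
have thB k : k \in B -> index (th k) (enum A) = index k (enum B) /\ th k \notin B.
  move=> Bk; have lt_k : (index k (enum B) < size (enum A))%N.
    by rewrite -cardE (leq_trans _ leBA) // cardE index_mem mem_enum.
  by rewrite /th Bk index_uniq ?enum_uniq // -AC -mem_enum mem_nth.
exists th; split.
- move=> k; have [Bk|nBk] := boolP (k \in B).
    have [eqi nBth] := thB k Bk.
    rewrite {1}/th (negbTE nBth) eqi cardE index_mem mem_enum Bk.
    by rewrite nth_index // mem_enum.
  rewrite {2}/th (negbTE nBk); case: ltnP => [lt_k|ge_k].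
    set k' := nth _ _ _; have Bk' : k' \in B by rewrite -mem_enum mem_nth // -cardE.
    have [eqi nBth] := thB k' Bk'.
    have eqk' : index k' (enum B) = index k (enum A).
      by rewrite /k' index_uniq ?enum_uniq // -cardE.
    by rewrite /th Bk' eqk' nth_index // mem_enum AC.
  by rewrite /th (negbTE nBk) ltnNge ge_k.
- by move=> k /thB[].
move=> l nBl; rewrite /th (negbTE nBl); case: ifP => // lt_l.
by rewrite -mem_enum mem_nth // -cardE.
Qed.

Section SVD.
Variable R : realType.
Local Notation C := R[i].

Lemma gram_diag_eq0 n p (X : 'M[C]_(n, p)) k :
  (adjm X *m X) k k = 0 -> forall i, X i k = 0.
Proof.
move=> X0; have : (adjm (col k X) *m col k X) 0 0 == 0.
  rewrite -X0 !adjm_mulE; apply/eqP; apply: eq_bigr => i _.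
  by rewrite !mxE.
by rewrite cV_sqnorm_eq0 => /eqP/colP c0 i; have := c0 i; rewrite !mxE.
Qed.

(** The columns of [W] in [B] are right singular vectors, eigenvectors of the square of [h] on [B].
    The column at [theta k] is the normalized image under [h] of the column at [k] when this is
    nonzero; the other columns complete the family orthonormally. *)
Lemma bipartite_svd N (A B : {set 'I_N}) (h : 'M[C]_N) :
  A :&: B = set0 -> A :|: B = [set: 'I_N] -> (#|B| <= #|A|)%N ->
  adjm h = h -> (forall i j, (i \in B) = (j \in B) -> h i j = 0) ->
  exists (W : 'M[C]_N) (theta : 'I_N -> 'I_N) (sig : 'I_N -> C),
    [/\ adjm W *m W = 1%:M, forall i k, (i \in B) != (k \in B) -> W i k = 0,
        forall i j, (adjm W *m h *m W) i j = sig i * (j == theta i)%:R &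
        [/\ involutive theta, forall k, k \in B -> theta k \notin B,
            forall l, l \notin B -> theta l \notin B -> theta l = l /\ sig l = 0,
            forall k, 0 <= sig k & forall k, sig (theta k) = sig k]].
Proof.
move=> AB0 ABT leBA hermh hblock.
have [theta [thK thB thnB]] := exists_pairing AB0 ABT leBA.
have hermK : adjm (h *m h) = h *m h by rewrite adjmM hermh.
have [V [d [V0 V1 Vd]]] := hermitian_block_spectral B hermK.
have [hV hVE] : exists X, X = h *m V by exists (h *m V).
have gram k l : k \in B -> l \in B -> (adjm hV *m hV) k l = (k == l)%:R * d k.
  by move=> Bk Bl; rewrite -Vd // hVE adjmM hermh !mulmxA.
have d_ge0 k : k \in B -> 0 <= d k.
  move=> Bk; have := gram k k Bk Bk; rewrite eqxx mul1r => <-.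
  by rewrite adjm_mulE sumr_ge0 // => i _; rewrite mulrC mul_conjC_ge0.
(* Partners share a singular value; unpaired modes of [A] get 0. *)
have [sig sigE] : exists sig : 'I_N -> C, forall k, sig k =
    if k \in B then sqrtC (d k) else
    if theta k \in B then sqrtC (d (theta k)) else 0 by eexists.
have sig_ge0 k : 0 <= sig k.
  by rewrite sigE; case: ifP => [Bk|_]; [|case: ifP => // Bk]; rewrite sqrtC_ge0 d_ge0.
have sig_th k : sig (theta k) = sig k.
  rewrite !sigE thK; have [Bk|nBk] := boolP (k \in B); first by rewrite (negbTE (thB k Bk)).
  by case: ifP => // nBtk.
have hV_B i k : i \in B -> hV i k = 0.
  move=> Bi; rewrite hVE mxE big1 // => j _.
  by have [Bj|nBj] := boolP (j \in B); [rewrite hblock ?mul0r ?Bi ?Bj|rewrite V0 ?mulr0].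
have sigV_real k : ((sig k)^-1)^* = (sig k)^-1.
  by rewrite conj_Creal // ger0_real // invr_ge0.
(* The left singular vectors with nonzero singular value; unit vectors on [B]
   force the completion of this family to be supported on [A]. *)
pose S := B :|: [set l | (theta l \in B) && (sig l != 0)].
pose Y := \matrix_(i, k) (if k \in B then (i == k)%:R else (sig k)^-1 * hV i (theta k)).
have orthoY k l : k \in S -> l \in S -> (adjm Y *m Y) k l = (k == l)%:R.
  rewrite !inE adjm_mulE => Sk Sl.
  have [Bk|nBk] := boolP (k \in B); have [Bl|nBl] := boolP (l \in B).
  - rewrite (bigD1 k) //= big1 => [|i ik]; last by rewrite !mxE Bk (negbTE ik) conjC0 mul0r.
    by rewrite !mxE Bk Bl eqxx conjC1 mul1r addr0.
  - rewrite big1 => [|i _]; last first.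
      rewrite !mxE Bk (negbTE nBl); case: eqP => [->|]; last by rewrite conjC0 mul0r.
      by rewrite hV_B // !mulr0.
    by case: eqP Bk nBl => // -> ->.
  - rewrite big1 => [|i _]; last first.
      rewrite !mxE Bl (negbTE nBk); case: eqP => [->|]; last by rewrite mulr0.
      by rewrite hV_B // mulr0 conjC0 mul0r.
    by case: eqP Bl nBk => // -> ->.
  rewrite (negbTE nBk) (negbTE nBl) /= in Sk Sl.
  case/andP: Sk => Btk sk0; case/andP: Sl => Btl sl0.
  transitivity ((sig k)^-1 * (sig l)^-1 * (adjm hV *m hV) (theta k) (theta l)).
    rewrite adjm_mulE mulr_sumr; apply: eq_bigr => i _.
    rewrite !mxE (negbTE nBk) (negbTE nBl) rmorphM /= sigV_real.
    by rewrite mulrACA.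
  rewrite gram // (inj_eq (can_inj thK)); case: eqP => [<-|_]; last by rewrite mul0r mulr0.
  have -> : d (theta k) = sig k ^+ 2 by rewrite sigE (negbTE nBk) Btk sqrtCK.
  by rewrite mul1r expr2 mulrACA mulVf // mulr1.
have [U [U1 UY]] := extend_orthonormal orthoY.
have U1E i k : (adjm U *m U) i k = (i == k)%:R by rewrite U1 mxE.
have U_supp i k : i \in B -> k \notin B -> U i k = 0.
  move=> Bi nBk; have := U1E i k; rewrite adjm_mulE.
  rewrite (bigD1 i) //= big1 => [|j ji]; last first.
    by rewrite UY ?inE ?Bi // mxE Bi (negbTE ji) conjC0 mul0r.
  rewrite UY ?inE ?Bi // mxE Bi eqxx conjC1 mul1r addr0 => ->.
  by case: eqP Bi nBk => // -> ->.
(* For a zero singular value the column of [hV] vanishes, so the identity holds for any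
   completion. *)
have hV_U i k : k \in B -> hV i k = sig k * U i (theta k).
  move=> Bk; have [s0|s_neq0] := eqVneq (sig k) 0.
    rewrite s0 mul0r; apply: (@gram_diag_eq0 _ _ hV).
    rewrite gram // eqxx mul1r; move: s0; rewrite sigE Bk => /eqP.
    by rewrite sqrtC_eq0 => /eqP.
  rewrite UY; last by rewrite !inE thK Bk sig_th s_neq0 orbT.
  by rewrite mxE (negbTE (thB k Bk)) sig_th thK mulrA divff // mul1r.
pose W := \matrix_(i, k) (if k \in B then V i k else U i k).
have W_supp i k : (i \in B) != (k \in B) -> W i k = 0.
  rewrite mxE; case: ifP => Bk; first by rewrite eqb_id => /V0.
  by rewrite eqbF_neg negbK => /U_supp -> //; rewrite Bk.
have hW i k : k \in B -> (h *m W) i k = sig k * U i (theta k).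
  by move=> Bk; rewrite -hV_U // hVE !mxE; apply: eq_bigr => j _; rewrite mxE Bk.
have hermG : adjm (adjm W *m h *m W) = adjm W *m h *m W.
  by rewrite !adjmM adjmK hermh mulmxA.
(* [h] exchanges [A] and [B] while [W] preserves them, so the diagonal blocks vanish; hermiticity
   will give the second off-diagonal block from the first. *)
have G_same i j : (i \in B) = (j \in B) -> (adjm W *m h *m W) i j = 0.
  move=> ij; rewrite mxE big1 // => l _; rewrite adjm_mulE.
  have [lj|lj] := eqVneq (l \in B) (j \in B); last by rewrite W_supp ?mulr0.
  rewrite big1 ?mul0r // => m _.
  have [ml|ml] := eqVneq (m \in B) (l \in B); first by rewrite hblock ?mulr0.
  by rewrite W_supp ?conjC0 ?mul0r // ij -lj.
have G_AB i j : i \notin B -> j \in B ->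
    (adjm W *m h *m W) i j = sig i * (j == theta i)%:R.
  move=> nBi Bj; rewrite -mulmxA adjm_mulE.
  under eq_bigr do rewrite mxE (negbTE nBi) hW // mulrCA.
  rewrite -mulr_sumr -adjm_mulE U1 mxE [i == _]eq_sym (can2_eq thK thK).
  by case: eqP => [->|]; rewrite ?sig_th ?mulr0.
exists W, theta, sig; split=> //.
- apply/matrixP => k l; rewrite adjm_mulE mxE.
  have [Bk|nBk] := boolP (k \in B); have [Bl|nBl] := boolP (l \in B).
  + by rewrite -V1 // adjm_mulE; apply: eq_bigr => i _; rewrite !mxE Bk Bl.
  + rewrite big1 => [|i _]; first by case: eqP Bk nBl => // -> ->.
    rewrite !mxE Bk (negbTE nBl); have [Bi|nBi] := boolP (i \in B).
      by rewrite U_supp ?mulr0.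
    by rewrite V0 ?conjC0 ?mul0r.
  + rewrite big1 => [|i _]; first by case: eqP Bl nBk => // -> ->.
    rewrite !mxE Bl (negbTE nBk); have [Bi|nBi] := boolP (i \in B).
      by rewrite U_supp ?conjC0 ?mul0r.
    by rewrite V0 ?mulr0.
  have := U1E k l; rewrite adjm_mulE => <-.
  by apply: eq_bigr => i _; rewrite !mxE (negbTE nBk) (negbTE nBl).
- move=> i j; have [Bi|nBi] := boolP (i \in B); have [Bj|nBj] := boolP (j \in B).
  + rewrite G_same ?Bi //; case: eqP => [jE|]; last by rewrite mulr0.
    by have := thB i Bi; rewrite -jE Bj.
  + rewrite -hermG adjmE G_AB // rmorphM /= conjC_nat conj_Creal ?ger0_real //.
    by rewrite [i == _]eq_sym (can2_eq thK thK); case: eqP => [->|]; rewrite ?sig_th ?mulr0.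
  + by rewrite G_AB.
  rewrite G_same ?(negbTE nBi) ?(negbTE nBj) //; case: eqP => [jE|]; last by rewrite mulr0.
  have nBt : theta i \notin B by rewrite -jE.
  by rewrite sigE (negbTE nBi) (negbTE nBt) mul0r.
split=> // l nBl nBtl; split; first exact: thnB.
by rewrite sigE (negbTE nBl) (negbTE nBtl).
Qed.

End SVD.

(** * Rotation within pairs *)

Section PairRotation.
Variable R : realType.
Local Notation C := R[i].

Definition rt2 : C := (sqrtC 2)^-1.

Lemma rt2_conj : rt2^* = rt2.
Proof. by rewrite conj_Creal // ger0_real // invr_ge0 sqrtC_ge0 ler0n. Qed.

Lemma rt2_sq : rt2 * rt2 = 2^-1.
Proof. by rewrite /rt2 -invfM -expr2 sqrtCK. Qed.

Variables (N : nat) (B : {set 'I_N}) (theta : 'I_N -> 'I_N).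
Hypothesis thK : involutive theta.
Hypothesis thB : forall k, k \in B -> theta k \notin B.
Hypothesis thnB : forall l, l \notin B -> theta l \notin B -> theta l = l.

(** Sign of the energy: after the rotation an index in [B] labels the lower mode of its pair and its
    partner the upper one, no longer a place in [B] or [A]. *)
Definition eps k : C := if k \in B then -1 else 1.

Lemma eps_conj k : (eps k)^* = eps k.
Proof. by rewrite /eps; case: ifP => _; rewrite ?conjC1 // conj_Creal // rpredN rpred1. Qed.

Lemma eps_sq k : eps k * eps k = 1.
Proof. by rewrite /eps; case: ifP => _; rewrite ?mulrNN mulr1. Qed.

Lemma eps_theta k : theta k != k -> eps (theta k) = - eps k.
Proof.
rewrite /eps; have [Bk _|nBk] := boolP (k \in B); first by rewrite (negbTE (thB Bk)) opprK.
by case: ifP => // /negbT nBt; rewrite (thnB nBk nBt) eqxx.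
Qed.

(** Column [k] is the symmetric or antisymmetric combination of a pair; indices without a partner
    are left alone. *)
Definition pair_rot : 'M[C]_N := \matrix_(i, k)
  if theta k == k then (i == k)%:R
  else rt2 * ((i == k)%:R + eps k * (i == theta k)%:R).

Lemma sum_delta (F : 'I_N -> C) k : \sum_i (i == k)%:R * F i = F k.
Proof.
rewrite (bigD1 k) //= eqxx mul1r big1 ?addr0 // => i /negbTE ->; exact: mul0r.
Qed.

Lemma sum_pair_rot (F : 'I_N -> C) k : \sum_i (pair_rot i k)^* * F i =
  if theta k == k then F k else rt2 * (F k + eps k * F (theta k)).
Proof.
under eq_bigr do rewrite mxE; case: ifP => _.
  by under eq_bigr do rewrite conjC_nat; rewrite sum_delta.
under eq_bigr do rewrite rmorphM rmorphD rmorphM /= rt2_conj eps_conj !conjC_nat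
  -mulrA mulrDl -mulrA.
by rewrite -mulr_sumr big_split /= -mulr_sumr !sum_delta.
Qed.

Lemma pair_rot_unitary : adjm pair_rot *m pair_rot = 1%:M.
Proof.
have thI := inj_eq (can_inj thK).
apply/matrixP => k l; rewrite adjm_mulE sum_pair_rot !mxE.
have [fk|nfk] := eqVneq (theta k) k; have [fl|nfl] := eqVneq (theta l) l => //.
- have [kl|_] := eqVneq k l; first by rewrite -kl fk eqxx in nfl.
  rewrite -{1}fk thI; have [kl|_] := eqVneq k l; first by rewrite -kl fk eqxx in nfl.
  by rewrite mulr0 addr0 mulr0.
- have [kl|_] := eqVneq k l; first by rewrite kl fl eqxx in nfk.
  rewrite -{1}fl thI; have [kl|_] := eqVneq k l; first by rewrite kl fl eqxx in nfk.
  by rewrite mulr0 addr0 mulr0.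
rewrite thI -[k == theta l](can2_eq thK thK).
have [kl|kl] := eqVneq k l.
  rewrite -kl (negbTE nfk) -[true%:R]/(1 : C) -[false%:R]/(0 : C).
  transitivity (rt2 * rt2 * (1 + eps k * eps k)); first by ring.
  by rewrite rt2_sq eps_sq; field.
rewrite -[false%:R]/(0 : C).
(* Off the diagonal only partners can contribute, and their signs are opposite. *)
transitivity (rt2 * rt2 * (eps l + eps k) * (theta k == l)%:R); first by ring.
case: eqP => [<-|_]; last by rewrite mulr0.
by rewrite eps_theta // addNr mulr0 mul0r.
Qed.

(** On a pair [G] is [sig] times the exchange of the two indices, whose eigenvectors are the
    symmetric and antisymmetric combinations. *)
Lemma pair_rot_diag (sig : 'I_N -> C) (G : 'M[C]_N) :
  (forall k, theta k = k -> sig k = 0) -> (forall k, sig (theta k) = sig k) ->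
  (forall i j, G i j = sig i * (j == theta i)%:R) ->
  forall k l, (adjm pair_rot *m G *m pair_rot) k l = (k == l)%:R * (eps k * sig k).
Proof.
move=> sig0 sig_th GE k l; rewrite -mulmxA adjm_mulE.
have GT i : (G *m pair_rot) i l = sig i * pair_rot (theta i) l.
  rewrite mxE; under eq_bigr do rewrite GE -mulrA.
  by rewrite -mulr_sumr sum_delta.
under eq_bigr do rewrite GT.
rewrite sum_pair_rot thK sig_th.
have -> : (k == l)%:R = (adjm pair_rot *m pair_rot) k l.
  by rewrite pair_rot_unitary mxE.
rewrite adjm_mulE sum_pair_rot; case: eqP => [/sig0 ->|_]; first by rewrite !mul0r !mulr0.
transitivity (rt2 * sig k * (pair_rot (theta k) l + eps k * pair_rot k l)); first by ring.
(* Inserting the square of [eps k], which is 1, lets [eps k] be factored out and leaves an entry of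
   the Gram matrix of the rotation. *)
transitivity (rt2 * sig k * (eps k * eps k * pair_rot (theta k) l + eps k * pair_rot k l)).
  by rewrite eps_sq mul1r.
ring.
Qed.

End PairRotation.

(** * Quadratic operators in terms of eigenmodes *)

Section Hamiltonian.
Variable R : realType.
Local Notation C := R[i].
Variables (N n : nat) (f : 'I_N -> 'M[C]_n).

Lemma modeTE (Q : 'M[C]_N) k : mode setT f Q k = \sum_j (Q j k)^* *: f j.
Proof. by apply: eq_bigl => j; rewrite inE. Qed.

Lemma second_quantization (M Q : 'M[C]_N) (e : 'I_N -> C) :
  (forall i j, M i j = \sum_k e k * (Q i k * (Q j k)^*)) ->
  \sum_k e k *: (adjm (mode setT f Q k) *m mode setT f Q k) =
  \sum_i \sum_j M i j *: (adjm (f i) *m f j).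
Proof.
move=> ME; under [RHS]eq_bigr do under eq_bigr do rewrite ME scaler_suml.
under [RHS]eq_bigr do rewrite exchange_big.
rewrite [RHS]exchange_big /=; apply: eq_bigr => k _.
rewrite modeTE adjm_sum mulmx_suml scaler_sumr; apply: eq_bigr => i _.
rewrite mulmx_sumr scaler_sumr; apply: eq_bigr => j _.
by rewrite adjmZ conjCK -scalemxAl -scalemxAr !scalerA mulrA.
Qed.

Lemma unitary_onT (Q : 'M[C]_N) : adjm Q *m Q = 1%:M -> unitary_on setT Q.
Proof.
move=> Q1; split=> [k l _ _|i j _ _]; under eq_bigl do rewrite inE.
  by rewrite -adjm_mulE Q1 mxE.
move/mulmx1C: Q1 => Q1; transitivity ((Q *m adjm Q) i j); last by rewrite Q1 mxE.
by rewrite mxE; apply: eq_bigr => k _; rewrite adjmE.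
Qed.

(** The double sum gives one off-diagonal block; its adjoint gives the other because [h] is
    Hermitian. *)
Lemma hopping_hamE (A B : {set 'I_N}) (h : 'M[C]_N) :
  A :&: B = set0 -> A :|: B = setT -> adjm h = h ->
  (forall i j, (i \in B) = (j \in B) -> h i j = 0) ->
  hopping_ham f A B h = \sum_i \sum_j h i j *: (adjm (f i) *m f j).
Proof.
move=> AB0 ABT hermh hblock; rewrite /hopping_ham.
have AC k : (k \in A) = (k \notin B).
  move/setP/(_ k): AB0; move/setP/(_ k): ABT; rewrite !inE.
  by case: (k \in A); case: (k \in B).
rewrite [RHS](bigID (mem A)) /=; congr (_ + _).
  apply: eq_bigr => i; rewrite AC => nBi.
  rewrite [RHS](bigID (mem B)) /= [X in _ = _ + X]big1 ?addr0 // => j nBj.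
  by rewrite hblock ?scale0r // (negbTE nBi) (negbTE nBj).
rewrite adjm_sum; under [LHS]eq_bigr => i _ do rewrite adjm_sum.
rewrite exchange_big /=.
rewrite [RHS](eq_bigl (mem B)) => [|i]; last by rewrite AC negbK.
apply: eq_bigr => i Bi.
rewrite [RHS](bigID (mem A)) /= [X in _ = _ + X]big1 ?addr0 => [|j].
  by apply: eq_bigr => j _; rewrite adjmZ adjmM adjmK -adjmE hermh.
by rewrite AC negbK => Bj; rewrite hblock ?scale0r // Bi Bj.
Qed.

Lemma number_opE :
  number_op f = \sum_i \sum_j (1%:M : 'M[C]_N) i j *: (adjm (f i) *m f j).
Proof.
apply: eq_bigr => i _; rewrite (bigD1 i) //= mxE eqxx scale1r big1 ?addr0 // => j ji.
by rewrite mxE eq_sym (negbTE ji) scale0r.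
Qed.

Lemma occupation (c : 'I_N -> 'M[C]_n) (s : 'I_N -> bool) (psi : 'cV[C]_n) k :
  CAR c -> flip c s k *m psi = 0 ->
  adjm (c k) *m c k *m psi = (s k)%:R *: psi.
Proof.
move=> car; rewrite /flip /fop /=; case: (s k) => c0; last first.
  by rewrite -mulmxA c0 mulmx0 scale0r.
have [cc _] := car k k (in_setT k) (in_setT k); rewrite eqxx in cc.
rewrite -[adjm (c k) *m c k](addKr (c k *m adjm (c k))) cc mulmxDl mulNmx -mulmxA c0.
by rewrite mulmx0 oppr0 add0r mul1mx scale1r.
Qed.

End Hamiltonian.

(** * Reduced state and entropy *)

Section FrozenModes.
Variable R : realType.
Local Notation C := R[i].
Variables (N n : nat) (S : {set 'I_N}) (d : 'I_N -> 'M[C]_n) (s : 'I_N -> bool).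
Hypothesis car : CAR_on S d.

(** The projector on mode [k] having occupation [s k]: d^dag d if occupied, d d^dag if empty. *)
Definition occ_proj k := fop d (k, s k) *m fop d (k, ~~ s k).

Definition frozen_proj (l : seq 'I_N) := mprod [seq occ_proj k | k <- l].

Lemma fop_sq k b : k \in S -> fop d (k, b) *m fop d (k, b) = 0.
Proof.
move=> Sk; have /eqP := CAR_fop car (x := (k, b)) (y := (k, b)) Sk Sk.
rewrite /= !eqxx /acomm -mulr2n -scaler_nat raddf0 scaler_eq0 pnatr_eq0 /=.
by move/eqP.
Qed.

Lemma fop_fop_fop k b : k \in S ->
  fop d (k, b) *m fop d (k, ~~ b) *m fop d (k, b) = fop d (k, b).
Proof.
move=> Sk; have := CAR_fop car (x := (k, b)) (y := (k, ~~ b)) Sk Sk.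
rewrite /= eqxx (_ : b != ~~ b) ?/acomm; last by case: b.
move/(congr1 (mulmx^~ (fop d (k, b)))).
by rewrite mulmxDl mul1mx -[X in _ + X]mulmxA fop_sq // mulmx0 addr0.
Qed.

Lemma adjm_occ_proj k : adjm (occ_proj k) = occ_proj k.
Proof. by rewrite adjmM !adjm_fop /= negbK. Qed.

Lemma occ_proj_idem k : k \in S -> occ_proj k *m occ_proj k = occ_proj k.
Proof. by move=> Sk; rewrite /occ_proj mulmxA fop_fop_fop. Qed.

Lemma fop_occ_projC k m b : k \in S -> m \in S -> m != k ->
  fop d (m, b) *m occ_proj k = occ_proj k *m fop d (m, b).
Proof.
move=> Sk Sm mk.
have anti c : fop d (m, b) *m fop d (k, c) = - (fop d (k, c) *m fop d (m, b)).
  by apply: acomm_eq0; rewrite (CAR_fop car) //= (negbTE mk) raddf0.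
by rewrite /occ_proj [LHS]mulmxA anti mulNmx -[in LHS]mulmxA anti mulmxN opprK mulmxA.
Qed.

Lemma fop_frozenC l m b : {subset l <= S} -> m \in S -> m \notin l ->
  fop d (m, b) *m frozen_proj l = frozen_proj l *m fop d (m, b).
Proof.
move=> lS Sm; elim: l lS => [|k l IH] lS; first by rewrite mulmx1 mul1mx.
rewrite inE negb_or => /andP[mk ml]; rewrite /frozen_proj /= -/(frozen_proj l).
have Sk : k \in S by rewrite lS ?mem_head.
rewrite mulmxA fop_occ_projC // -!mulmxA IH // => j lj.
by rewrite lS // inE lj orbT.
Qed.

Lemma occ_proj_frozenC l k : {subset l <= S} -> k \in S -> k \notin l ->
  occ_proj k *m frozen_proj l = frozen_proj l *m occ_proj k.
Proof.
by move=> lS Sk kl; rewrite /occ_proj -mulmxA fop_frozenC // mulmxA fop_frozenC // -mulmxA.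
Qed.

Lemma frozen_proj_projector l : {subset l <= S} -> uniq l ->
  adjm (frozen_proj l) = frozen_proj l /\
  frozen_proj l *m frozen_proj l = frozen_proj l.
Proof.
elim: l => [|k l IH] lS /=; first by rewrite /frozen_proj /= adjm1 mulmx1.
case/andP=> kl /IH[j lj|adjl idl]; first by rewrite lS // inE lj orbT.
have lS' : {subset l <= S} by move=> j lj; rewrite lS // inE lj orbT.
have Sk : k \in S by rewrite lS ?mem_head.
rewrite /frozen_proj /= -/(frozen_proj l); have OF := occ_proj_frozenC lS' Sk kl.
split; first by rewrite adjmM adjl adjm_occ_proj OF.
by rewrite -mulmxA [frozen_proj l *m (_ *m _)]mulmxA -OF -mulmxA idl mulmxA occ_proj_idem.
Qed.

Lemma fop_frozen0 l k : {subset l <= S} -> k \in l -> fop d (k, s k) *m frozen_proj l = 0.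
Proof.
move=> lS kl; elim: l lS kl => [//|m l IH] lS; rewrite /frozen_proj /= -/(frozen_proj l).
have lS' : {subset l <= S} by move=> j lj; rewrite lS // inE lj orbT.
have Sm : m \in S by rewrite lS ?mem_head.
rewrite inE; have [->|km] /= := eqVneq k m.
  by rewrite /occ_proj !mulmxA fop_sq // !mul0mx.
by move=> lk; have Sk := lS' k lk; rewrite mulmxA fop_occ_projC // -mulmxA IH // mulmx0.
Qed.

Lemma frozen_fop0 l k : {subset l <= S} -> uniq l -> k \in l ->
  frozen_proj l *m fop d (k, ~~ s k) = 0.
Proof.
move=> lS ul lk; have [adjl _] := frozen_proj_projector lS ul.
by rewrite -[LHS]adjmK adjmM adjl adjm_fop /= negbK fop_frozen0 // adjm0.
Qed.

(** By cyclicity the projectors on mode [k] occupied and on [k] empty have the same trace against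
    the rest; since they add up to 1, each frozen mode halves the trace. *)
Lemma tr_frozen_proj l : {subset l <= S} -> uniq l ->
  (2 ^ size l)%:R * \tr (frozen_proj l) = n%:R.
Proof.
elim: l => [|k l IH] lS /=; first by rewrite /frozen_proj /= mxtrace1 mul1r.
case/andP=> kl ul; have lS' : {subset l <= S} by move=> j lj; rewrite lS // inE lj orbT.
have Sk : k \in S by rewrite lS ?mem_head.
rewrite -(IH lS' ul) expnS mulnC natrM -mulrA; congr (_ * _).
rewrite mulr_natl mulr2n {1}/frozen_proj /= -/(frozen_proj l) /occ_proj.
rewrite -{1}mulmxA fop_frozenC // mulmxA mxtrace_mulC mulmxA.
have -> : \tr (frozen_proj (k :: l)) =
    \tr (fop d (k, s k) *m fop d (k, ~~ s k) *m frozen_proj l) by [].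
rewrite -mxtraceD -mulmxDl -/(acomm _ _) (CAR_fop car) //= eqxx (_ : ~~ s k != s k).
  by rewrite mul1mx.
by case: (s k).
Qed.

Lemma frozen_parityC (G : 'M[C]_n) l : {subset l <= S} ->
  (forall x, x.1 \in S -> G *m fop d x = - (fop d x *m G)) ->
  G *m frozen_proj l = frozen_proj l *m G.
Proof.
move=> lS antiG; elim: l lS => [|k l IH] lS; first by rewrite mulmx1 mul1mx.
have lS' : {subset l <= S} by move=> j lj; rewrite lS // inE lj orbT.
have Sk : k \in S by rewrite lS ?mem_head.
rewrite /frozen_proj /= -/(frozen_proj l) -mulmxA -IH // !mulmxA; congr (_ *m _).
by rewrite antiG // mulNmx -!mulmxA antiG // mulmxN opprK.
Qed.

End FrozenModes.

Section Reduced.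
Variable R : realType.
Local Notation C := R[i].
Variables (N : nat) (B : {set 'I_N}) (V : 'M[C]_N) (s q : 'I_N -> bool).
Hypothesis uV : unitary_on B V.

Definition frozen_seq := enum [set k in B | q k].

(** 1 for the operator annihilating the state, 0 for its adjoint, 1/2 on the modes that [q] does not
    mark as frozen. *)
Definition weight (x : 'I_N * bool) : C := if q x.1 then (x.2 == s x.1)%:R else 2^-1.

(** Frozen modes: a trace with nonzero coefficient vanishes, as the operator meets the projector.
    Other modes: the operator commutes with the projector, cyclicity equates the two traces, and
    parity makes them vanish when the total word is odd. *)
Lemma frozen_kms n (g : 'I_N -> 'M[C]_n) (G : 'M[C]_n) (c : C) :
  CAR_on B g -> adjm G = G -> G *m G = 1%:M ->
  (forall j, j \in B -> G *m g j = - (g j *m G)) ->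
  kms B V weight g (c *: frozen_proj (mode B g V) s frozen_seq).
Proof.
move=> car adjG GG Gg k b w Bk Bw.
have card := CAR_mode car uV.
have lB : {subset frozen_seq <= B} by move=> j; rewrite mem_enum inE => /andP[].
have ul : uniq frozen_seq by apply: enum_uniq.
have Gfop x : x.1 \in B -> G *m fop g x = - (fop g x *m G).
  case: x => j [] /= Bj; rewrite /fop /=; last exact: Gg.
  by rewrite -[G in LHS]adjG -adjmM -[g j *m G]opprK -Gg // adjmN adjmM adjG.
have Gmode x : G *m fop (mode B g V) x = - (fop (mode B g V) x *m G).
  case: x => j e; rewrite fop_mode mulmx_suml mulmx_sumr -sumrN; apply: eq_bigr => i Bi.
  by rewrite -scalemxAr -scalemxAl Gfop // scalerN.
have Gword : G *m word g w = (-1) ^+ size w *: (word g w *m G).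
  elim: w Bw => [|x w IH] /=; first by rewrite mulmx1 mul1mx scale1r.
  case/andP=> Bx /IH eqG; rewrite /word /= -/(word g w) [LHS]mulmxA Gfop //.
  rewrite mulNmx -[in LHS]mulmxA eqG.
  by rewrite -scalemxAr mulmxA exprS mulN1r scaleNr.
rewrite /weight /=; set P := frozen_proj _ _ _; set y := fop _ _.
rewrite -!scalemxAl !mxtraceZ.
have kl : (k \in frozen_seq) = q k by rewrite mem_enum inE Bk.
case: ifP => qk.
  have [bs|bs] := eqVneq b (s k).
    have -> : \tr (P *m (word g w *m y)) = 0.
      rewrite mxtrace_mulC -mulmxA /y bs (fop_frozen0 s card) ?kl //.
      by rewrite mulmx0 mxtrace0.
    by rewrite subrr mul0r !mulr0 oppr0.
  have -> : \tr (P *m (y *m word g w)) = 0.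
    rewrite mulmxA /y (_ : b = ~~ s k); last by case: (b) (s k) bs => [] [].
    by rewrite (frozen_fop0 s card) ?kl // mul0mx mxtrace0.
  by rewrite !mulr0 mul0r oppr0.
have yP : y *m P = P *m y by apply: (fop_frozenC s card) => //; rewrite kl qk.
have -> : \tr (P *m (word g w *m y)) = \tr (P *m (y *m word g w)).
  by rewrite mulmxA mxtrace_mulC !mulmxA yP.
have GP : G *m P = P *m G by apply: (frozen_parityC s lB) => x _; exact: Gmode.
set Z := y *m word g w; have GZ : G *m Z = - (-1) ^+ size w *: (Z *m G).
  rewrite /Z [LHS]mulmxA Gmode mulNmx -[in LHS]mulmxA Gword -scalemxAr scaleNr.
  by rewrite [in LHS]mulmxA.
(* Inserting the square of [G], which is 1, and moving one [G] around the trace multiplies it by the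
   parity of the word. *)
clearbody Z; have trZ : \tr (P *m Z) = - (-1) ^+ size w * \tr (P *m Z).
  rewrite -[in LHS](mulmx1 Z) -[in LHS]GG !mulmxA mxtrace_mulC !mulmxA GP.
  rewrite -[P *m G *m Z]mulmxA GZ -scalemxAr -scalemxAl mxtraceZ.
  by rewrite -!mulmxA GG mulmx1.
by rewrite [in LHS]trZ; field.
Qed.

(* [x] is the partner mode in [A], which on [psi] acts as the mode [k] up to a
   sign and can be carried through the word of modes in [B]. *)
Lemma state_kms n (f : 'I_N -> 'M[C]_n) (psi : 'cV[C]_n) :
  (forall k, k \in B -> q k -> fop (mode B f V) (k, s k) *m psi = 0) ->
  (forall k, k \in B -> ~~ q k -> exists x : bool -> 'M[C]_n,
    [/\ forall b, adjm (x b) = x (~~ b),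
        forall b, fop (mode B f V) (k, b) *m psi = (-1) ^+ (b != s k) *: (x b *m psi) &
        forall b z, z.1 \in B -> acomm (x b) (fop f z) = 0]) ->
  kms B V weight f (psi *m adjm psi).
Proof.
move=> frozen paired k b w Bk Bw; rewrite -!expectE /weight /=; case: ifP => qk.
  have [bs|bs] := eqVneq b (s k).
    rewrite [X in _ = - (_ * X)]expect_annihil_r; last by rewrite bs frozen.
    by rewrite subrr mul0r mulr0 oppr0.
  rewrite expect_annihil_l; first by rewrite !mulr0 mul0r oppr0.
  by rewrite adjm_fop /= (_ : ~~ b = s k) ?frozen //; case: (b) (s k) bs => [] [].
have [x [adjx xpsi antix]] := paired k Bk (negbT qk).
have xword : x b *m word f w = (-1) ^+ size w *: (word f w *m x b).
  elim: w Bw => [|z w IH] /=; first by rewrite mulmx1 mul1mx scale1r.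
  case/andP=> Bz /IH eqx; rewrite /word /= -/(word f w) [LHS]mulmxA.
  rewrite (acomm_eq0 (antix b z Bz)) mulNmx -[in LHS]mulmxA eqx.
  by rewrite -scalemxAr mulmxA exprS mulN1r scaleNr.
rewrite [in LHS]expect_mulmx adjm_fop /= xpsi adjmZ -scalemxAl mxE rmorphXn rmorphN1.
rewrite -adjx -expect_mulmx xword expectZ.
rewrite [in RHS]/expect -!mulmxA xpsi -!scalemxAr mxE !mulmxA -/(expect psi _).
have -> : (~~ b != s k) = ~~ (b != s k) by case: (b) (s k) => [] [].
rewrite -[adjm psi *m _ *m x b]mulmxA -/(expect psi _).
by case: (b != s k) => /=; rewrite ?expr0 ?expr1; field.
Qed.

End Reduced.

(** * Entropy of normalized projectors *)

Section Entropy.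
Variable R : realType.
Local Notation C := R[i].

(** A flat spectrum has the same entropy at every index: (1 - alpha)^-1 log2 (2^m 2^(- m alpha)) =
    m, and the von Neumann case gives m as well. *)
Lemma flat_renyi n (T : {set 'I_n}) m (alpha : R) : #|T| = (2 ^ m)%N ->
  renyi_of (fun i => if i \in T then (2 ^+ m)^-1 else 0) alpha = m%:R :> R.
Proof.
move=> cardT; have p_gt0 : 0 < 2 ^+ m :> R by rewrite exprn_gt0.
have ln2_neq0 : ln 2 != 0 :> R by rewrite gt_eqF // ln_gt0 // ltr1n.
have supp i : ((if i \in T then (2 ^+ m)^-1 else 0) != 0 :> R) = (i \in T).
  by case: ifP; rewrite ?eqxx // invr_eq0 gt_eqF.
have sumE (F : R -> R) : \sum_(i < n | (if i \in T then (2 ^+ m)^-1 else 0) != 0 :> R)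
    F (if i \in T then (2 ^+ m)^-1 else 0) = 2 ^+ m * F (2 ^+ m)^-1.
  rewrite (eq_bigl _ _ supp) (eq_bigr (fun=> F (2 ^+ m)^-1)) => [|i ->] //.
  by rewrite sumr_const cardT -[LHS]mulr_natl natrX.
have lnV_p : ln ((2 ^+ m)^-1) = - (m%:R * ln 2) :> R.
  by rewrite lnV ?posrE // lnXn // mulr_natl.
rewrite /renyi_of; case: eqP => [_|/eqP alpha1].
  rewrite (sumE (fun x => x * log2 x)) mulrA divff ?gt_eqF // mul1r /log2 lnV_p.
  by rewrite mulNr opprK mulfK.
rewrite (sumE (fun x => x `^ alpha)) /log2 lnM ?posrE ?powR_gt0 ?invr_gt0 //.
rewrite ln_powR lnV_p lnXn // -[ln 2 *+ m]mulr_natl.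
by field; rewrite ln2_neq0 subr_eq0 eq_sym alpha1.
Qed.

(** The eigenvalues of a projector are 0 and 1, and the trace counts the ones. *)
Lemma projector_spectrum n (P : 'M[C]_n) m :
  adjm P = P -> P *m P = P -> \tr P = (2 ^ m)%:R ->
  exists d : 'I_n -> R, is_spectrum ((2 ^+ m)^-1 *: P) d /\
    forall alpha, renyi_of d alpha = m%:R.
Proof.
move=> hermP idemP trP; have [U [e [U1 PE]]] := hermitian_spectral hermP.
have ee i : e i * e i = e i.
  have : adjm U *m (P *m P) *m U = adjm U *m P *m U by rewrite idemP.
  rewrite PE !mulmxA U1 mul1mx -!mulmxA U1 mulmx1 !mulmxA -[_ *m adjm U *m U]mulmxA U1 mulmx1.
  move/matrixP/(_ i i); rewrite mul_diag_mx !mxE !eqxx.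
  by rewrite !mulr1n.
have e01 i : e i = (e i != 0)%:R.
  have [->//|e0] := eqVneq (e i) 0.
  by apply: (mulfI e0); rewrite ee mulr1.
pose T := [set i | e i != 0].
exists (fun i => if i \in T then (2 ^+ m)^-1 else 0); split; last first.
  move=> alpha; apply: flat_renyi; apply/eqP; rewrite -(eqr_nat C) -trP PE mxtrace_mulC.
  rewrite mulmxA U1 mul1mx mxtrace_diag; under eq_bigr do rewrite mxE e01.
  rewrite -natr_sum -sum1_card big_mkcond /=; apply/eqP; congr (_%:R).
  by apply: eq_bigr => i _; rewrite inE; case: (e i != 0).
exists U; split=> //; rewrite PE scalemxAl scalemxAr; congr (_ *m _ *m _).
apply/matrixP => i j; rewrite !mxE inE; case: (i == j); rewrite ?mulr0n ?mulr0 //.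
rewrite !mulr1n e01; case: (e i != 0); rewrite ?oner_eq0 ?eqxx ?mulr0 // mulr1.
by rewrite (fmorphV (real_complex R)) rmorphXn /= (rmorph_nat (real_complex R)).
Qed.

(** The reduced state is the projector freezing the modes marked by [q], divided by its trace 2^m
    with [m] the number of unmarked modes in [B]; uniqueness of the moments identifies it. *)
Lemma reduced_entropy N n (f : 'I_N -> 'M[C]_n) (B : {set 'I_N}) (V : 'M[C]_N)
    (s q : 'I_N -> bool) (psi : 'cV[C]_n) alpha :
  CAR f -> unitary_on B V -> adjm psi *m psi = 1%:M ->
  kms B V (weight R s q) f (psi *m adjm psi) ->
  renyi_entropy f B psi alpha #|[set k in B | ~~ q k]|%:R.
Proof.
move=> carf uV psi1 kmsf; set m := #|_|.
have [g [G [carg adjG GG Gg]]] := @exists_CAR R N B _ erefl.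
have card := CAR_mode carg uV.
have lB : {subset frozen_seq B q <= B} by move=> j; rewrite mem_enum inE => /andP[].
have ul : uniq (frozen_seq B q) by apply: enum_uniq.
have [adjP PP] := frozen_proj_projector s card lB ul.
set P := frozen_proj _ _ _ in adjP PP.
have cardB : #|B| = (#|[set k in B | q k]| + m)%N.
  rewrite -(cardsID [set k | q k] B); congr (_ + _)%N; apply: eq_card => k.
    by rewrite !inE.
  by rewrite !inE andbC.
have trP : \tr P = (2 ^ m)%:R.
  have := tr_frozen_proj s card lB ul; rewrite -/P -cardE => eqP.
  apply: (@mulfI _ (2 ^ #|[set k in B | q k]|)%:R); first by rewrite pnatr_eq0 expn_eq0.
  by rewrite eqP cardB expnD natrM.
have [d [specd renyid]] := projector_spectrum adjP PP trP.
exists ((2 ^+ m)^-1 *: P), d; split; last by split=> //; exact: renyid.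
exists g; split=> // w Bw; rewrite expectE.
apply: (kms_unique carg _ uV (frozen_kms s q uV _ carg adjG GG Gg) kmsf) => //.
  by move=> i j _ _; apply: carf; rewrite inE.
rewrite mxtraceZ trP natrX mulVf ?expf_neq0 ?pnatr_eq0 //.
by rewrite mxtrace_mulC psi1 mxtrace1.
Qed.

End Entropy.

(** * Eigenstates *)

Section Eigenstates.
Variable R : realType.
Local Notation C := R[i].
Variables (N n : nat) (f : 'I_N -> 'M[C]_n).

(** The two vectors belong to the distinct eigenvalues 0 and 1 of one Hermitian occupation
    operator. *)
Lemma occupation_orthogonal (c : 'I_N -> 'M[C]_n) (s t : 'I_N -> bool)
    (phi psi : 'cV[C]_n) k :
  CAR c -> flip c s k *m phi = 0 -> flip c t k *m psi = 0 -> s k != t k ->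
  adjm phi *m psi = 0.
Proof.
move=> car phi0 psi0 st.
have : adjm (adjm (c k) *m c k *m phi) *m psi = adjm phi *m (adjm (c k) *m c k *m psi).
  by rewrite !adjmM adjmK !mulmxA.
rewrite (occupation car phi0) (occupation car psi0) adjmZ conjC_nat -scalemxAl -scalemxAr.
case: (s k) (t k) st => [] [] // _; first by rewrite scale1r scale0r.
by rewrite scale1r scale0r => <-.
Qed.

Lemma occupation_eigen (c : 'I_N -> 'M[C]_n) (e : 'I_N -> C) (s : 'I_N -> bool)
    (psi : 'cV[C]_n) :
  CAR c -> (forall k, flip c s k *m psi = 0) ->
  (\sum_k e k *: (adjm (c k) *m c k)) *m psi = (\sum_k e k * (s k)%:R) *: psi.
Proof.
move=> car vac; rewrite mulmx_suml scaler_suml; apply: eq_bigr => k _.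
by rewrite -scalemxAl (occupation car (vac k)) scalerA.
Qed.

(** The bound is the energy with exactly the labels in [B] filled. Subtracting it turns each term
    with [k] in [B] into [sig k] times c c^dag, so every term is nonnegative. *)
Lemma lowest_occupation (c : 'I_N -> 'M[C]_n) (B : {set 'I_N}) (sig : 'I_N -> C)
    (e : C) (w : 'cV[C]_n) :
  CAR c -> (forall k, 0 <= sig k) -> w != 0 ->
  (\sum_k (eps R B k * sig k) *: (adjm (c k) *m c k)) *m w = e *: w ->
  \sum_k eps R B k * sig k * (k \in B)%:R <= e.
Proof.
move=> car sig0 w0 He; set x := adjm w *m w.
have x_gt0 : 0 < x 0 0 by rewrite lt_neqAle eq_sym cV_sqnorm_eq0 w0 cV_sqnorm_ge0.
rewrite -(ler_pM2r x_gt0) -subr_ge0.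
have -> : e * x 0 0 = \sum_k eps R B k * sig k * (adjm (c k *m w) *m (c k *m w)) 0 0.
  have -> : e * x 0 0 = (adjm w *m (e *: w)) 0 0 by rewrite -scalemxAr [RHS]mxE.
  rewrite -He mulmx_suml mulmx_sumr summxE; apply: eq_bigr => k _.
  by rewrite adjmM -scalemxAl -scalemxAr [LHS]mxE !mulmxA.
rewrite mulr_suml -sumrB sumr_ge0 // => k _; rewrite /eps.
have [Bk|nBk] := boolP (k \in B); last first.
  by rewrite mulr0 mul0r subr0 mul1r mulr_ge0 // cV_sqnorm_ge0.
have [cc _] := car k k (in_setT k) (in_setT k); rewrite eqxx in cc.
have -> : x = adjm (c k *m w) *m (c k *m w) + adjm (adjm (c k) *m w) *m (adjm (c k) *m w).
  rewrite !adjmM adjmK -!mulmxA -mulmxDr !mulmxA -mulmxDl addrC cc mul1mx //.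
set u := adjm (c k *m w) *m _; set v := adjm (adjm (c k) *m w) *m _.
rewrite mulr1 [(u + v) 0 0]mxE.
rewrite (_ : _ - _ = sig k * v 0 0); last by ring.
by rewrite mulr_ge0 // cV_sqnorm_ge0.
Qed.

Variables (B : {set 'I_N}) (theta : 'I_N -> 'I_N) (W : 'M[C]_N).
Hypothesis thK : involutive theta.
Hypothesis thB : forall k, k \in B -> theta k \notin B.
Hypothesis W_supp : forall i k, (i \in B) != (k \in B) -> W i k = 0.

(** In the application [d] are the singular modes, each localized in [A] or in [B], and [c] are the
    eigenmodes, which mix partners. *)
Local Notation d := (mode setT f W).
Local Notation c := (mode setT f (W *m pair_rot R B theta)).

Lemma mode_block k : k \in B -> mode B f W k = d k.
Proof.
move=> Bk; rewrite modeTE /mode big_mkcond; apply: eq_bigr => j _.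
by case: ifPn => // nBj; rewrite W_supp ?conjC0 ?scale0r // Bk (negbTE nBj).
Qed.

Lemma fop_block k b : k \in B -> fop (mode B f W) (k, b) = fop d (k, b).
Proof. by move=> Bk; rewrite /fop /= mode_block. Qed.

Lemma mode_pair k : theta k != k -> c k = rt2 R *: (d k + eps R B k *: d (theta k)).
Proof.
move=> nfk; rewrite !modeTE scaler_sumr -big_split /= scaler_sumr; apply: eq_bigr => j _.
rewrite scalerA -scalerDl scalerA; congr (_ *: _).
have := sum_pair_rot B theta (fun i => (W j i)^*) k; rewrite (negbTE nfk) => <-.
by rewrite mxE rmorph_sum; apply: eq_bigr => i _; rewrite rmorphM mulrC.
Qed.

Lemma fop_pair k b : k \in B ->
  fop d (k, b) = rt2 R *: (fop c (k, b) + fop c (theta k, b)) /\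
  fop d (theta k, b) = rt2 R *: (fop c (theta k, b) - fop c (k, b)).
Proof.
move=> Bk; have nBt := thB Bk.
have nfk : theta k != k by apply: contraNneq nBt => ->.
have nft : theta (theta k) != theta k by rewrite thK eq_sym.
have ck := mode_pair nfk; have ct := mode_pair nft.
rewrite thK {1}/eps (negbTE nBt) scale1r in ct; rewrite /eps Bk scaleN1r in ck.
have rt2D : rt2 R * rt2 R + rt2 R * rt2 R = 1 by rewrite rt2_sq; field.
have dk : d k = rt2 R *: (c k + c (theta k)).
  rewrite ck ct -scalerDr [d (theta k) + _]addrC addrACA addNr addr0 scalerA scalerDr.
  by rewrite -scalerDl rt2D scale1r.
have dt : d (theta k) = rt2 R *: (c (theta k) - c k).
  rewrite ck ct -scalerBr opprB addrACA subrr addr0 scalerA scalerDr.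
  by rewrite -scalerDl rt2D scale1r.
case: b; rewrite /fop //=; split.
  by rewrite dk adjmZ adjmD rt2_conj.
by rewrite dt adjmZ adjmD adjmN rt2_conj.
Qed.

(** Equal occupations: both eigenmode operators kill [psi], hence so does their sum, and the [B]
    mode is frozen. Unequal occupations: for each [b] one of the two drops out, so the [B] mode and
    its partner in [A] act on [psi] alike up to sign. *)
Lemma eigenstate_kms (s : 'I_N -> bool) (psi : 'cV[C]_n) :
  CAR f -> (forall k, flip c s k *m psi = 0) ->
  kms B W (weight R s (fun k => s k == s (theta k))) f (psi *m adjm psi).
Proof.
move=> car vac; apply: state_kms => k Bk sk.
  rewrite fop_block // (fop_pair (s k) Bk).1.
  by rewrite -scalemxAl mulmxDl (vac k) {1}(eqP sk) (vac (theta k)) addr0 scaler0.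
exists (fun b => fop d (theta k, b)); split.
- by move=> b; rewrite adjm_fop.
- move=> b; rewrite fop_block //.
  have [-> ->] := fop_pair b Bk; rewrite -!scalemxAl mulmxDl mulmxBl.
  have [->|bs] := eqVneq b (s k).
    by rewrite (vac k) add0r subr0 scale1r.
  have -> : b = s (theta k).
    by move: bs sk => /=; case: (b); case: (s k); case: (s (theta k)).
  by rewrite (vac (theta k)) addr0 sub0r expr1 scaleN1r scalerN opprK.
move=> b z Bz; rewrite acomm_mode ?inE // W_supp ?Bz ?(negbTE (thB Bk)) //.
by case: b; rewrite /= ?conjC0 mulr0 raddf0.
Qed.

End Eigenstates.

(** * Assembly of the eigenbasis *)

Theorem theorem1 (R : realType) (N : nat) (f : 'I_N -> 'M[R[i]]_(2 ^ N))
    (A B : {set 'I_N}) (h : 'M[R[i]]_N) :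
  (0 < N)%N ->
  CAR f ->
  A :&: B = set0 -> A :|: B = [set: 'I_N] -> (#|B| <= #|A|)%N ->
  adjm h = h ->
  (forall i j, ((i \in A) && (j \in A)) || ((i \in B) && (j \in B)) -> h i j = 0) ->
  exists (E : {ffun 'I_N -> bool} -> 'cV[R[i]]_(2 ^ N))
         (n : {ffun 'I_N -> bool} -> nat),
    (forall s t, adjm (E s) *m E t = (s == t)%:R%:M) /\
    (forall s, pure_gaussian f (E s)) /\
    (forall s, exists e : R[i], hopping_ham f A B h *m E s = e *: E s) /\
    (forall s, exists m : R[i], number_op f *m E s = m *: E s) /\
    (forall s, (n s <= #|B|)%N) /\
    (forall s (alpha : R), 0 <= alpha -> renyi_entropy f B (E s) alpha (n s)%:R) /\
    (exists s, ground_state (hopping_ham f A B h) (E s) /\ n s = #|B|).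
Proof.
move=> _ car AB0 ABT leBA hermh hAB.
have AC k : (k \in A) = (k \notin B).
  move/setP/(_ k): AB0; move/setP/(_ k): ABT; rewrite !inE.
  by case: (k \in A); case: (k \in B).
have hblock i j : (i \in B) = (j \in B) -> h i j = 0.
  by move=> ij; apply: hAB; rewrite !AC ij; case: (j \in B).
have [W [theta [sig [W1 W_supp WhW [thK thB thnB sig_ge0 sig_th]]]]] :=
  bipartite_svd AB0 ABT leBA hermh hblock.
have thnB1 l : l \notin B -> theta l \notin B -> theta l = l.
  by move=> lB /(thnB l lB)[].
have [Q QE] : exists Q, Q = W *m pair_rot R B theta by eexists.
pose e k := eps R B k * sig k.
have Q1 : adjm Q *m Q = 1%:M.
  by rewrite QE adjmM -mulmxA [adjm W *m _]mulmxA W1 mul1mx pair_rot_unitary.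
have Qh k l : (adjm Q *m h *m Q) k l = (k == l)%:R * e k.
  rewrite QE adjmM !mulmxA -[_ *m adjm W *m h]mulmxA -[_ *m (adjm W *m h) *m W]mulmxA.
  (* A fixed point of [theta] lies outside [B], so it is an unpaired mode, where [sig] vanishes. *)
  apply: pair_rot_diag => // m thm; apply: (proj2 (thnB m _ _)); last rewrite thm.
    by apply/negP => Bm; have := thB m Bm; rewrite thm Bm.
  by apply/negP => Bm; have := thB m Bm; rewrite thm Bm.
have Q1' := mulmx1C Q1.
have hQ i j : h i j = \sum_k e k * (Q i k * (Q j k)^*).
  have -> : h = Q *m (adjm Q *m h *m Q) *m adjm Q.
    by rewrite !mulmxA Q1' mul1mx -mulmxA Q1' mulmx1.
  rewrite mxE; apply: eq_bigr => k _; rewrite mxE (bigD1 k) //= big1 => [|l lk].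
    by rewrite Qh eqxx mul1r adjmE; ring.
  by rewrite Qh (negbTE lk) mul0r mulr0.
have idQ i j : (1%:M : 'M_N) i j = \sum_k 1 * (Q i k * (Q j k)^*).
  by rewrite -Q1' mxE; apply: eq_bigr => k _; rewrite mul1r adjmE.
pose c := mode setT f Q.
have uQ := unitary_onT Q1; have carc : CAR c := CAR_mode car uQ.
have HE : hopping_ham f A B h = \sum_k e k *: (adjm (c k) *m c k).
  by rewrite (hopping_hamE f AB0 ABT hermh hblock) -(second_quantization f hQ).
have NE : number_op f = \sum_k 1 *: (adjm (c k) *m c k).
  by rewrite number_opE -(second_quantization f idQ).
(* Since [W] does not mix [A] and [B], its block on [B] is itself unitary. *)
have uW : unitary_on B W.
  have [u1 u2] := unitary_onT W1; split=> [k l Bk Bl|i j Bi Bj].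
    rewrite -u1 ?inE // [RHS](bigID (mem B)) /= [X in _ + X]big1 ?addr0.
      by apply: eq_bigl => j; rewrite inE.
    by move=> j /andP[_ nBj]; rewrite W_supp ?conjC0 ?mul0r // Bk (negbTE nBj).
  rewrite -u2 ?inE // [RHS](bigID (mem B)) /= [X in _ + X]big1 ?addr0.
    by apply: eq_bigl => k; rewrite inE.
  by move=> k /andP[_ nBk]; rewrite W_supp ?mul0r // Bi (negbTE nBk).
(* [E s] is a vacuum of the eigenmodes flipped according to [s], chosen for all [s] at once. *)
have /fin_all_exists[E E_vac] : forall s : {ffun 'I_N -> bool},
    exists v : 'cV[R[i]]_(2 ^ N),
      adjm v *m v = 1%:M /\ forall k, flip c s k *m v = 0.
  move=> s; have [|v [v1 v0]] := CAR_vacuum (CAR_flip s carc); first by rewrite expn_gt0.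
  by exists v; split=> // k; apply: v0; rewrite inE.
have E1 s := (E_vac s).1; have E0 s := (E_vac s).2.
(* The number of pairs with exactly one eigenmode occupied. *)
pose n (s : {ffun 'I_N -> bool}) := #|[set k in B | ~~ (s k == s (theta k))]|.
exists E, n; split.
  move=> s t; have [<-|st] := eqVneq s t; first exact: E1.
  rewrite raddf0; have [k stk] : exists k, s k != t k.
    apply/existsP; rewrite -negb_forall; apply: contra st => /forallP st.
    by apply/eqP/ffunP => k; apply/eqP.
  exact: occupation_orthogonal carc (E0 s k) (E0 t k) stk.
split; first by move=> s; apply: gaussian_vacuum car uQ (E1 s) (E0 s).
split; first by move=> s; eexists; rewrite HE; exact: occupation_eigen carc (E0 s).
split.
  by move=> s; eexists; rewrite NE; exact: (occupation_eigen (fun=> 1) carc (E0 s)).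
split.
  by move=> s; apply: subset_leq_card; apply/subsetP => k; rewrite inE => /andP[].
split.
  move=> s alpha _.
  have vac k : flip (mode setT f (W *m pair_rot R B theta)) s k *m E s = 0.
    by rewrite -QE; exact: E0.
  exact: (reduced_entropy alpha car uW (E1 s) (eigenstate_kms thK thB W_supp car vac)).
(* Filling the labels in [B] occupies only the lower mode of each pair, so every pair counts in [n];
   unpaired modes, of energy 0, stay empty. *)
exists [ffun k => k \in B]; split; last first.
  apply: eq_card => k; rewrite !inE !ffunE; have [Bk|//] := boolP (k \in B).
  by rewrite (negbTE (thB k Bk)).
set s := [ffun k => _]; split.
  apply/eqP => Es0; have /matrixP/(_ 0 0) := E1 s; rewrite Es0 mulmx0 !mxE eqxx.
  by move/eqP; rewrite eq_sym oner_eq0.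
exists (\sum_k e k * (s k)%:R); split.
  by rewrite HE; exact: occupation_eigen carc (E0 s).
move=> e' w w0; rewrite HE => Hw.
under eq_bigr do rewrite ffunE.
exact: (lowest_occupation carc sig_ge0 w0 Hw).
Qed.
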